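(* Let $(\mathcal{A},\mathbb{E},\mathcal{B})$ be an operator-valued $C^\ast$-probability space and let $s$ be a centered $\mathcal{B}$-valued semicircular element in $\mathcal{A}$ with covariance $\eta:\mathcal{B}\to\mathcal{B}$. Fix $b\in\mathbb{H}^+(\mathcal{B})$ and let $w_\ast:=G_s(b)\in\mathbb{H}^-(\mathcal{B})$ be the unique solution in $\mathbb{H}^-(\mathcal{B})$ of the equation $bw=\mathbf{1}+\eta(w)w$. Suppose that $\tilde w_\ast\in\mathbb{H}^-(\mathcal{B})$ is an approximate solution of this equation in the sense that, with $\Delta_b(w):=b-w^{-1}-\eta(w)$, $$\|\Delta_b(\tilde w_\ast)\|\le\sigma\|\operatorname{Im}(b)^{-1}\|^{-1}$$ holds for some $\sigma\in(0,1)$. Then $$\|\tilde w_\ast-w_\ast\|\le\frac{1}{1-\sigma}\|\operatorname{Im}(b)^{-1}\|^2\|\Delta_b(\tilde w_\ast)\|\le\frac{\sigma}{1-\sigma}\|\operatorname{Im}(b)^{-1}\|.$$ Further, if $\phi$ is a state on $\mathcal{B}$ and $\Theta_s(b):=-\|\operatorname{Im}(b)^{-1}\|^{-1}\operatorname{Im}(\phi(G_s(b)))$, then $$|\phi(\tilde w_\ast)-\phi(w_\ast)|\le\frac{1}{1-\sigma}\sqrt{\Theta_s(b)}\,\|\operatorname{Im}(b)^{-1}\|^2\|\Delta_b(\tilde w_\ast)\|\le\frac{\sigma}{1-\sigma}\sqrt{\Theta_s(b)}\,\|\operatorname{Im}(b)^{-1}\|.$$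
   Context: For a unital $C^\ast$-algebra $\mathcal{B}$ with unit $\mathbf{1}$, put $\operatorname{Im}(b):=\frac{1}{2i}(b-b^\ast)$ and $\mathbb{H}^\pm(\mathcal{B}):=\{b\in\mathcal{B}\mid\exists\,\epsilon>0:\ \pm\operatorname{Im}(b)\ge\epsilon\mathbf{1}\}$; elements of $\mathbb{H}^\pm(\mathcal{B})$ are invertible. An operator-valued $C^\ast$-probability space $(\mathcal{A},\mathbb{E},\mathcal{B})$ consists of a unital $C^\ast$-algebra $\mathcal{A}$, a $C^\ast$-subalgebra $\mathcal{B}\subseteq\mathcal{A}$ containing the unit of $\mathcal{A}$, and a conditional expectation $\mathbb{E}:\mathcal{A}\to\mathcal{B}$ (positive linear, $\mathbb{E}[b]=b$ and $\mathbb{E}[b_1xb_2]=b_1\mathbb{E}[x]b_2$ for $b,b_1,b_2\in\mathcal{B}$, $x\in\mathcal{A}$). For $x=x^\ast\in\mathcal{A}$, the $\mathcal{B}$-valued Cauchy transform is $G_x:\mathbb{H}^+(\mathcal{B})\to\mathbb{H}^-(\mathcal{B})$, $G_x(b):=\mathbb{E}[(b-x)^{-1}]$. A selfadjoint $s\in\mathcal{A}$ is a centered $\mathcal{B}$-valued semicircular element with covariance $\eta$, where $\eta:\mathcal{B}\to\mathcal{B}$ is a positive linear map (then automatically completely positive, since $\eta(b)=\mathbb{E}[sbs]$), if $\mathbb{E}[b_0sb_1s\cdots b_{k-1}sb_k]=\sum_{\pi\in NC_2(k)}\eta_\pi(b_0,\dots,b_k)$ for all $k\in\mathbb{N}$ and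 $b_0,\dots,b_k\in\mathcal{B}$, where $NC_2(k)$ is the set of non-crossing pairings of $\{1,\dots,k\}$ (empty for odd $k$) and $\eta_\pi$ is defined recursively: if $(p,p+1)$ is a block of $\pi$ and $\pi'\in NC_2(k-2)$ is obtained by removing it, then $\eta_\pi(b_0,\dots,b_k)=\eta_{\pi'}(b_0,\dots,b_{p-2},b_{p-1}\eta(b_p)b_{p+1},b_{p+2},\dots,b_k)$, with $\eta_\emptyset(b_0)=b_0$ for the empty pairing. It is known that, for each $b\in\mathbb{H}^+(\mathcal{B})$, $w=G_s(b)$ is the unique solution in $\mathbb{H}^-(\mathcal{B})$ of $bw=\mathbf{1}+\eta(w)w$ when $s$ is a centered $\mathcal{B}$-valued semicircular element with covariance $\eta$. *)

(* Defs.v *)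
From HB Require Import structures.
From mathcomp Require Import all_boot all_order all_algebra.
From mathcomp Require Import reals.
From mathcomp Require Import complex.

Set Implicit Arguments.
Unset Strict Implicit.
Unset Printing Implicit Defensive.

Import Order.TTheory GRing.Theory Num.Theory.
Import ComplexField.Normc.

Local Open Scope ring_scope.
Local Open Scope complex_scope.

(* Unital C*-algebras over R[i].  The hierarchy does not allow joining a ring
   with the normed modules of the library, hence the explicit norm.  The
   unitAlgType structure adds no data: the units of a ring and their inverses
   are determined by its multiplication.  The zero algebra is excluded, since
   1 != 0 in every unitAlgType. *)
HB.mixin Record isCStar (R : realType) A & GRing.UnitAlgebra R[i] A := {
  cnorm : A -> R;
  cnorm_eq0 : forall x : A, cnorm x = 0 -> x = 0;
  cnormD : forall x y : A, cnorm (x + y) <= cnorm x + cnorm y;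
  cnormZ : forall (c : R[i]) (x : A), cnorm (c *: x) = normc c * cnorm x;
  cnormM : forall x y : A, cnorm (x * y) <= cnorm x * cnorm y;
  cnorm_complete : forall u : nat -> A,
    (forall e : R, 0 < e -> exists N, forall m n, (N <= m)%N -> (N <= n)%N ->
       cnorm (u m - u n) < e) ->
    exists l, forall e : R, 0 < e -> exists N, forall n, (N <= n)%N ->
       cnorm (u n - l) < e;
  star : A -> A;
  starK : involutive star;
  starD : {morph star : x y / x + y};
  starZ : forall (c : R[i]) (x : A), star (c *: x) = c^* *: star x;
  starM : forall x y : A, star (x * y) = star y * star x;
  cnorm_star : forall x : A, cnorm (star x * x) = cnorm x ^+ 2
}.

#[short(type="cstarType")]
HB.structure Definition CStar (R : realType) :=
  {A of GRing.UnitAlgebra R[i] A & isCStar R A}.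

Section CStarAlgebra.
Variables (R : realType) (B : cstarType R).
Implicit Types x y b : B.

Definition selfadjoint x := star x = x.

Definition cpos x := exists y, x = star y * y.

Definition cle x y := cpos (y - x).

Definition imag b : B := (2 * 'i)^-1 *: (b - star b).

Definition upper_half b := exists2 e : R, 0 < e & cle (e%:C *: 1) (imag b).

Definition lower_half b := exists2 e : R, 0 < e & cle (e%:C *: 1) (- imag b).

Definition is_state (phi : {linear B -> R[i]^o}) :=
  (forall x, cpos x -> 0 <= (phi x : R[i])) /\ phi 1 = 1.

End CStarAlgebra.

Definition positive_map (R : realType) (B C : cstarType R) (f : B -> C) :=
  forall x, cpos x -> cpos (f x).

(* The inclusion of the C*-subalgebra B into A is the isometric unital
   *-homomorphism [incl]; the image of such a map is closed since B is
   complete. *)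
Record cstar_prob_space (R : realType) (A B : cstarType R) := CStarProbSpace {
  incl : {lrmorphism B -> A};
  incl_star : forall b, incl (star b) = star (incl b);
  incl_norm : forall b, cnorm (incl b) = cnorm b;
  expect : {linear A -> B};
  expect_pos : positive_map expect;
  expect_incl : forall b, expect (incl b) = b;
  expect_bimod : forall b1 x b2,
    expect (incl b1 * x * incl b2) = b1 * expect x * b2
}.

Definition cauchy_transform (R : realType) (A B : cstarType R)
    (P : cstar_prob_space A B) (x : A) (b : B) : B :=
  expect P (incl P b - x)^-1.

Section NonCrossingPairings.

Definition pairing k (pi : {set {set 'I_k}}) : bool :=
  partition pi [set: 'I_k] && [forall V in pi, #|V| == 2%N].

Definition noncrossing k (pi : {set {set 'I_k}}) : bool :=
  [forall V in pi, forall W in pi, (V != W) ==>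
    ~~ [exists i in V, exists j in W, exists i' in V, exists j' in W,
        [&& (i < j)%N, (j < i')%N & (i' < j')%N]]].

Definition NC2 k : {set {set {set 'I_k}}} :=
  [set pi | pairing pi & noncrossing pi].

(* Points are numbered from 0: this is the pair {p, p + 1}. *)
Definition adjacent k (p : 'I_k.+1) : {set 'I_k.+2} :=
  [set lift ord_max p; lift ord0 p].

(* The increasing bijection from 'I_k onto the complement of {p, p + 1}. *)
Definition skip k (p : 'I_k.+1) (j : 'I_k) : 'I_k.+2 :=
  lift (lift ord0 p) (lift p j).

Definition remove_adjacent k (p : 'I_k.+1) (pi : {set {set 'I_k.+2}}) :
    {set {set 'I_k}} :=
  [set skip p @^-1: (V : {set 'I_k.+2}) | V in pi :\ adjacent p].

Variables (R : realType) (B : cstarType R) (eta : B -> B).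

Definition contract (p : nat) (b : nat -> B) (j : nat) : B :=
  if (j < p)%N then b j
  else if j == p then b p * eta (b p.+1) * b p.+2
  else b j.+2.

(* [eta_pairing pi b] only depends on b 0, ..., b k.  A nonempty non-crossing
   pairing has an adjacent block, and the value does not depend on the one
   that is picked; the default 0 is only returned when pi is not in NC2 k. *)
Fixpoint eta_pairing (k : nat) : {set {set 'I_k}} -> (nat -> B) -> B :=
  match k with
  | 0 => fun _ b => b 0%N
  | 1 => fun _ _ => 0
  | k'.+2 => fun pi b =>
      if [pick p : 'I_k'.+1 | adjacent p \in pi] is Some p
      then eta_pairing (remove_adjacent p pi) (contract p b)
      else 0
  end.

End NonCrossingPairings.

Definition semicircular (R : realType) (A B : cstarType R)
    (P : cstar_prob_space A B) (eta : {linear B -> B}) (s : A) : Prop :=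
  [/\ selfadjoint s,
      positive_map eta
    & forall (k : nat) (b : nat -> B),
        expect P (incl P (b 0%N) * \prod_(i < k) (s * incl P (b i.+1)))
        = \sum_(pi in NC2 k) eta_pairing eta pi b].

Definition Delta (R : realType) (B : cstarType R) (eta : B -> B) (b w : B) : B :=
  b - w^-1 - eta w.

Definition Theta (R : realType) (A B : cstarType R) (P : cstar_prob_space A B)
    (s : A) (phi : {linear B -> R[i]^o}) (b : B) : R :=
  - (cnorm (imag b)^-1)^-1 * complex.Im (phi (cauchy_transform P s b)).

(* Main.v *)
Require Import Defs.
From HB Require Import structures.
From mathcomp Require Import all_boot all_order all_algebra.
From mathcomp Require Import reals.
From mathcomp Require Import complex.
From mathcomp Require Import ring lra zify.
From Stdlib Require Ncring Ncring_tac.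
Import Order.TTheory GRing.Theory Num.Theory.
Import ComplexField.Normc.
Local Open Scope ring_scope.

(** Put [bt := b - Delta_b(wt)].  The approximate solution [wt] is an exact
    solution of the equation for [bt], and [Im bt >= (1 - sigma) / K] with
    [K := |Im(b)^-1|].  If [wt = G_s(bt)], then
      [wt - G_s(b) = E((b - s)^-1 Delta_b(wt) (bt - s)^-1)],
    and the first estimate follows from [|(c - s)^-1| <= 1 / e] for
    [Im c >= e] ([imag_ge_unit]).  For a state [phi] the Cauchy-Schwarz
    inequality for [phi o E] ([state_cauchy_schwarz]) replaces one factor
    [|(b - s)^-1|] by the square root of the value of [phi o E] at [R R^*],
    where [R := (b - s)^-1], and [R R^* <= - K Im R].

    It remains to prove that [G_s(bt)] solves the equation and that the solution
    in the lower half-plane is unique.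

    Existence.  Decomposing a noncrossing pairing at the partner of its first
    point turns the moments of [s] into the recursion [moment_rec].  Pairings are
    evaluated by removing their leftmost adjacent block, so the recursion is
    derived from the one-step rule [psum_step], in which the number of points
    that have been opened but not yet closed is a parameter.  Summed over all
    degrees, the recursion is the Schwinger-Dyson equation
    [E(s R) = eta(E R) (E R)] for resolvents [R] that are given by their Neumann
    series ([sd_res_large]).  The power series of the resolvent around
    [b + i t0] converges up to [b], which extends the equation to the whole
    half-plane ([sd_res]).

    Uniqueness.  If [w1], [w2] are solutions and [vi := - Im wi], then
    [x := w1 - w2 = w1 eta(x) w2], whereas [w1 eta(v1) w1^* <= q v1] and
    [w2^* eta(v2) w2 <= q v2] for some [q < 1].  Since [eta(y) = E(s y s)] is
    2-positive, positivity of the matrix with rows [M v1, x] and [x^*, M v2]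
    passes from [M] to [q M] ([schur_contract]); hence [x = 0].

    All this needs the order of a C*-algebra, which is developed from the norm
    up to the theorem that [y^* y] is positive ([pos_star]).  Square roots come
    from a contraction ([sqrt_near1]), and instead of a functional calculus only
    resolvents of [y^* y] are used ([pos_star_step]). *)

Set Implicit Arguments.
Unset Strict Implicit.
Unset Printing Implicit Defensive.
Local Open Scope complex_scope.

(** * Geometric decay *)
Section RealLimits.
Variable R : realType.
Implicit Types q e : R.

(** The sum [1 + q + ... + q^(n - 1)] has [n] terms, each at least [q^n]. *)
Lemma natr_exp_bound q n : 0 <= q < 1 -> n%:R * q ^+ n * (1 - q) <= 1 - q ^+ n.
Proof.
move=> /andP[q0 q1]; elim: n => [|n IH]; first by rewrite !mul0r expr0 subrr.
have qn0 : 0 <= q ^+ n by apply: exprn_ge0.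
have qn1 : q ^+ n <= 1 by apply: exprn_ile1 => //; apply: ltW.
rewrite -natr1 exprS; have IHq := ler_wpM2l q0 IH.
have h : 0 <= (1 - q) * (1 - q * q ^+ n).
  by rewrite mulr_ge0 ?subr_ge0 ?mulr_ile1 // ltW.
by move: IHq h; set p := q ^+ n; set m : R := n%:R => IHq h; lra.
Qed.

Lemma exp_small q e : 0 <= q < 1 -> 0 < e ->
  exists N, forall n, (N <= n)%N -> q ^+ n < e.
Proof.
move=> /andP[q0 q1] e0.
have d0 : 0 < e * (1 - q) by apply: mulr_gt0 => //; lra.
exists (Num.truncn (e * (1 - q))^-1).+1 => n hn.
have := @natr_exp_bound q n; rewrite q0 q1 => /(_ isT) h.
have qn0 : 0 <= q ^+ n by apply: exprn_ge0.
have hn' : (e * (1 - q))^-1 < n%:R.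
  by apply: lt_le_trans (truncnS_gt _) _; rewrite ler_nat.
have h1 : 1 < n%:R * (e * (1 - q)) by rewrite -ltr_pdivrMr // mul1r.
set p := q ^+ n in h qn0 *; set m : R := n%:R in h h1 hn'.
have m0 : 0 < m by rewrite (lt_trans _ hn') // invr_gt0.
rewrite ltNge; apply/negP => hep.
have : m * (e * (1 - q)) <= m * p * (1 - q).
  by rewrite !mulrA ler_wpM2r; [|lra|rewrite ler_wpM2l // ltW].
lra.
Qed.

Lemma natr_exp_small (q e K : R) : 0 <= q < 1 -> 0 < e ->
  exists N, forall n, (N <= n)%N -> K * (n.+1%:R * q ^+ n) < e.
Proof.
move=> /andP[q0 q1] e0; pose r := (1 + q) / 2.
have [r0 r1] : 0 <= r /\ r < 1 by rewrite /r; split; lra.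
have qr : q <= r ^+ 2 by rewrite /r; nra.
pose M := 1 + (1 - r)^-1; pose K' := `|K| * M + 1.
have M0 : 0 <= M by rewrite addr_ge0 // invr_ge0; lra.
have K0 : 0 < K' by rewrite /K' ltr_wpDl // mulr_ge0.
have [|N hN] := @exp_small r (e / K') _ (divr_gt0 e0 K0); first by rewrite r0.
exists N => n /hN; rewrite ltr_pdivlMr // => h.
have rn0 : 0 <= r ^+ n by apply: exprn_ge0.
have rn1 : r ^+ n <= 1 by apply: exprn_ile1 => //; apply: ltW.
have qrn : q ^+ n <= r ^+ n * r ^+ n.
  by rewrite -exprD addnn -mul2n exprM lerXn2r // nnegrE exprn_ge0.
have hb : n.+1%:R * r ^+ n <= M.
  rewrite -natr1 mulrDl mul1r /M addrC lerD //.
  have := @natr_exp_bound r n; rewrite r0 r1 => /(_ isT) hb.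
  rewrite -[_^-1]mul1r ler_pdivlMr; last by lra.
  lra.
have step : n.+1%:R * q ^+ n <= M * r ^+ n.
  apply: le_trans (_ : n.+1%:R * (r ^+ n * r ^+ n) <= _).
    by rewrite ler_wpM2l.
  by rewrite mulrA ler_wpM2r.
apply: le_lt_trans h; apply: le_trans (_ : `|K| * (n.+1%:R * q ^+ n) <= _).
  by rewrite ler_wpM2r ?ler_norm // mulr_ge0 // exprn_ge0.
apply: le_trans (_ : `|K| * (M * r ^+ n) <= _); first by rewrite ler_wpM2l.
rewrite /K'; nra.
Qed.

End RealLimits.

(** * Identities in noncommutative rings *)
Section NonCommutativeRing.
Variables (R : realType) (A : cstarType R).

(** The operations under which the noncommutative [ring] tactic of the standard
    library recognizes terms of a C*-algebra. *)
#[export] Instance nc_ring_ops : @Ncring.Ring_ops A 0 1 +%R *%R (fun x y => x - y)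
  -%R (@eq A) := {}.

#[export] Instance nc_ring : Ncring.Ring (Ro := nc_ring_ops).
Proof.
split; try by move=> *; subst.
- exact: RelationClasses.eq_equivalence.
- by move=> a b -> c d ->.
- by move=> a b -> c d ->.
- by move=> a b -> c d ->.
- by move=> a b ->.
- by move=> x; apply: add0r.
- by move=> x y; apply: addrC.
- by move=> x y z; apply: addrA.
- by move=> x; apply: mul1r.
- by move=> x; apply: mulr1.
- by move=> x y z; apply: mulrA.
- by move=> x y z; apply: mulrDl.
- by move=> x y z; apply: mulrDr.
- by move=> x; apply: subrr.
Qed.

End NonCommutativeRing.

(** Identities that hold in every, possibly noncommutative, ring. *)
Ltac ncring := Ncring_tac.non_commutative_ring.

(** * Norms, real scalars and square roots *)
Section Banach.
Variables (R : realType) (A : cstarType R).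
Implicit Types (x y z u v : A) (t e : R).

Definition sc t : A := t%:C *: 1.

Lemma scD s t : sc (s + t) = sc s + sc t.
Proof. by rewrite /sc rmorphD scalerDl. Qed.
Lemma scN t : sc (- t) = - sc t.
Proof. by rewrite /sc rmorphN scaleNr. Qed.
Lemma scB s t : sc (s - t) = sc s - sc t.
Proof. by rewrite scD scN. Qed.
Lemma sc0 : sc 0 = 0. Proof. by rewrite /sc rmorph0 scale0r. Qed.
Lemma sc1 : sc 1 = 1. Proof. by rewrite /sc rmorph1 scale1r. Qed.
Lemma scE t x : t%:C *: x = sc t * x.
Proof. by rewrite /sc -scalerAl mul1r. Qed.
Lemma scM s t : sc (s * t) = sc s * sc t.
Proof. by rewrite -scE /sc scalerA -rmorphM. Qed.
Lemma scC t x : x * sc t = sc t * x.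
Proof. by rewrite -scE /sc -scalerAr mulr1. Qed.
Lemma sc2 : sc 2 = 1 + 1.
Proof. by rewrite -sc1 -scD. Qed.
Lemma scV t : t != 0 -> sc t * sc t^-1 = 1.
Proof. by move=> t0; rewrite -scM mulfV // sc1. Qed.
Lemma scK t x : t != 0 -> sc t * (sc t^-1 * x) = x.
Proof. by move=> t0; rewrite mulrA scV // mul1r. Qed.
Lemma scVK t x : t != 0 -> sc t^-1 * (sc t * x) = x.
Proof. by move=> t0; rewrite -{2}(invrK t) scK // invr_neq0. Qed.

Lemma normc_real t : normc t%:C = `|t|.
Proof. by rewrite /normc /= expr0n /= addr0 sqrtr_sqr. Qed.
Lemma normc_i : normc ('i : R[i]) = 1.
Proof. by rewrite /normc /= expr0n /= add0r expr1n sqrtr1. Qed.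

Lemma cnorm0 : cnorm (0 : A) = 0.
Proof. by rewrite -(scale0r (0 : A)) cnormZ normc0 mul0r. Qed.
Lemma cnormN x : cnorm (- x) = cnorm x.
Proof. by rewrite -scaleN1r cnormZ normcN normc1 mul1r. Qed.
Lemma cnormBC x y : cnorm (x - y) = cnorm (y - x).
Proof. by rewrite -cnormN opprB. Qed.
Lemma cnormB x y : cnorm (x - y) <= cnorm x + cnorm y.
Proof. by rewrite -(cnormN y) cnormD. Qed.
Lemma cnorm_ge0 x : 0 <= cnorm x.
Proof. by have := cnormB x x; rewrite subrr cnorm0; lra. Qed.
Lemma cnorm_dist x y z : cnorm (x - z) <= cnorm (x - y) + cnorm (y - z).
Proof. by apply: le_trans (cnormD _ _); rewrite addrA subrK. Qed.
Lemma cnorm_sum (I : Type) (r : seq I) (P : pred I) (F : I -> A) :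
  cnorm (\sum_(i <- r | P i) F i) <= \sum_(i <- r | P i) cnorm (F i).
Proof.
elim/big_ind2: _ => //=; first by rewrite cnorm0.
by move=> x1 x2 y1 y2 h1 h2; apply: le_trans (cnormD _ _) _; apply: lerD.
Qed.
Lemma cnormM_le x y s t : cnorm x <= s -> cnorm y <= t ->
  cnorm (x * y) <= s * t.
Proof.
by move=> hs ht; apply: le_trans (cnormM _ _) _; apply: ler_pM => //;
  apply: cnorm_ge0.
Qed.
Lemma cnormD_le x y s t : cnorm x <= s -> cnorm y <= t ->
  cnorm (x + y) <= s + t.
Proof. by move=> hs ht; apply: le_trans (cnormD _ _) _; apply: lerD. Qed.

Lemma star0 : star (0 : A) = 0.
Proof. by apply: (addIr (star 0)); rewrite -starD !add0r. Qed.
Lemma star1 : star (1 : A) = 1.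
Proof. by have := starM (star 1) (1 : A); rewrite mulr1 starK mulr1. Qed.
Lemma starN x : star (- x) = - star x.
Proof. by apply/eqP; rewrite -addr_eq0 -starD addNr star0. Qed.
Lemma starB x y : star (x - y) = star x - star y.
Proof. by rewrite starD starN. Qed.
Lemma conj_real t : Num.conj (t%:C : R[i]) = t%:C.
Proof. exact: (conjc_real t). Qed.
Lemma star_sc t : star (sc t) = sc t.
Proof. by rewrite /sc starZ star1 conj_real. Qed.
Lemma starV x : x \is a GRing.unit -> star x^-1 = (star x)^-1.
Proof.
move=> xu; apply: (@mulrI _ (star x)); last first.
  rewrite -starM mulVr // star1 mulrV //.
  by apply/unitrP; exists (star x^-1); rewrite -!starM mulVr // mulrV // star1.
by apply/unitrP; exists (star x^-1); rewrite -!starM mulVr // mulrV // star1.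
Qed.
Lemma star_unit x : (star x \is a GRing.unit) = (x \is a GRing.unit).
Proof.
suff h y : y \is a GRing.unit -> star y \is a GRing.unit.
  by apply/idP/idP => /h; rewrite ?starK.
by move=> yu; apply/unitrP; exists (star y^-1);
  rewrite -!starM mulVr // mulrV // star1.
Qed.

Lemma cnorm_starE x : cnorm (star x) = cnorm x.
Proof.
have h y : cnorm y <= cnorm (star y).
  have [y0|y0] := eqVneq (cnorm y) 0; first by rewrite y0 cnorm_ge0.
  have := cnormM (star y) y; rewrite cnorm_star expr2 ler_pM2r //.
  by rewrite lt_def y0 cnorm_ge0.
by apply: le_anti; rewrite h -{2}(starK x) h.
Qed.
Lemma cnorm_sqr x : selfadjoint x -> cnorm (x * x) = cnorm x ^+ 2.
Proof. by move=> xs; rewrite -cnorm_star xs. Qed.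
Lemma cnorm1 : cnorm (1 : A) = 1.
Proof.
have h : cnorm (1 : A) != 0.
  by apply/eqP => /cnorm_eq0/eqP; rewrite oner_eq0.
by apply: (mulIf h); rewrite mul1r -expr2 -cnorm_star star1 mul1r.
Qed.
Lemma cnorm_sc t : cnorm (sc t) = `|t|.
Proof. by rewrite /sc cnormZ normc_real cnorm1 mulr1. Qed.
Lemma cnorm_scM t x : cnorm (sc t * x) = `|t| * cnorm x.
Proof. by rewrite -scE cnormZ normc_real. Qed.
Lemma cnormV_gt0 x : x \is a GRing.unit -> 0 < cnorm x^-1.
Proof.
move=> xu; rewrite lt_def cnorm_ge0 andbT; apply/eqP => /cnorm_eq0 h.
by have := mulrV xu; rewrite h mulr0 => /esym/eqP; rewrite oner_eq0.
Qed.
Lemma cnormX x n : cnorm (x ^+ n) <= cnorm x ^+ n.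
Proof.
elim: n => [|n IH]; first by rewrite !expr0 cnorm1.
by rewrite !exprS cnormM_le.
Qed.

Lemma cnorm_small0 x : (forall e, 0 < e -> cnorm x < e) -> x = 0.
Proof.
move=> h; apply: cnorm_eq0; apply/eqP; rewrite eq_le cnorm_ge0 andbT leNgt.
by apply/negP => /h; rewrite ltxx.
Qed.

(** Banach's fixed point theorem on the closed ball of radius [rho] around 0;
    the fixed point is a limit of iterates of 0, so that it inherits the closed
    properties which they share. *)
Lemma contraction_fixpoint (F : A -> A) (rho q : R) :
  0 <= q < 1 -> 0 <= rho ->
  (forall x, cnorm x <= rho -> cnorm (F x) <= rho) ->
  (forall x y, cnorm x <= rho -> cnorm y <= rho ->
     cnorm (F x - F y) <= q * cnorm (x - y)) ->
  exists l, [/\ cnorm l <= rho, F l = l &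
    forall e, 0 < e -> exists n, cnorm (iter n F 0 - l) < e].
Proof.
move=> q01 rho0 Frho Fq; have /andP[q0 q1] := q01.
pose u n := iter n F 0.
have urho n : cnorm (u n) <= rho.
  by elim: n => [|n IH] /=; [rewrite cnorm0 | apply: Frho].
have uq n k : cnorm (u (n + k)%N - u n) <= q ^+ n * rho.
  elim: n => [|n IH]; first by rewrite add0n subr0 mul1r.
  rewrite addSn /=; apply: le_trans (Fq _ _ (urho _) (urho _)) _.
  by rewrite exprS -mulrA ler_wpM2l.
have rho1 : 0 < rho + 1 by lra.
have uC e : 0 < e -> exists N, forall m n, (N <= m)%N -> (N <= n)%N ->
    cnorm (u m - u n) < e.
  move=> e0; have [|N hN] := @exp_small R q (e / 2 / (rho + 1)) q01.
    by rewrite !divr_gt0.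
  have {}hN : q ^+ N * rho < e / 2.
    have := hN N (leqnn _); rewrite ltr_pdivlMr //.
    by have := exprn_ge0 N q0; nra.
  exists N => m n hm hn; rewrite -(subnKC hm) -(subnKC hn).
  apply: le_lt_trans (cnorm_dist _ (u N) _) _.
  rewrite [X in _ + X]cnormBC.
  have := uq N (m - N)%N; have := uq N (n - N)%N; lra.
have [l hl] := cnorm_complete u uC.
have lrho : cnorm l <= rho.
  apply/ler_addgt0Pr => e e0; have [N /(_ N (leqnn _)) hN] := hl _ e0.
  have := cnorm_dist l (u N) 0; rewrite !subr0 cnormBC.
  by have := urho N; lra.
exists l; split=> //; last first.
  by move=> e /hl[N /(_ N (leqnn _)) hN]; exists N.
apply/eqP; rewrite -subr_eq0; apply/eqP; apply: cnorm_small0 => e e0.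
have [N hN] := hl (e / 2) (divr_gt0 e0 (ltr0Sn _ 1)).
apply: le_lt_trans (cnorm_dist _ (u N.+1) _) _.
have h1 := hN N.+1 (leqnSn _); have h2 := hN N (leqnn _).
have h3 := Fq l (u N) lrho (urho N); rewrite (cnormBC l) in h3.
have : q * cnorm (u N - l) <= cnorm (u N - l).
  by rewrite ler_piMl ?cnorm_ge0 // ltW.
by rewrite /= in h1 *; lra.
Qed.

(** A right and a left inverse of [x] are the fixed points of the contractions
    [y |-> 1 + (1 - x) y] and [y |-> 1 + y (1 - x)]. *)
Lemma neumann_unit x : cnorm (1 - x) < 1 -> x \is a GRing.unit.
Proof.
move=> hx; pose q := cnorm (1 - x).
have q0 : 0 <= q by apply: cnorm_ge0.
have rho0 : 0 <= (1 - q)^-1 by rewrite invr_ge0 subr_ge0 ltW.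
have rhoE : 1 + q * (1 - q)^-1 = (1 - q)^-1.
  by field; rewrite subr_eq0 eq_sym lt_eqF.
have q01 : 0 <= q < 1 by rewrite q0.
have [||l [_ hl _]] :=
  @contraction_fixpoint (fun y => 1 + (1 - x) * y) (1 - q)^-1 q q01 rho0.
- move=> y hy; rewrite -rhoE; apply: cnormD_le; first by rewrite cnorm1.
  exact: cnormM_le.
- by move=> y z _ _; rewrite opprD addrACA subrr add0r -mulrBr cnormM_le.
have [||r [_ hr _]] :=
  @contraction_fixpoint (fun y => 1 + y * (1 - x)) (1 - q)^-1 q q01 rho0.
- move=> y hy; rewrite -rhoE; apply: cnormD_le; first by rewrite cnorm1.
  by rewrite mulrC; apply: cnormM_le.
- move=> y z _ _; rewrite opprD addrACA subrr add0r -mulrBl mulrC.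
  exact: cnormM_le.
have xl : x * l = 1.
  apply/eqP; rewrite -subr_eq0 -[X in _ - X](addrK ((1 - x) * l)) hl.
  by apply/eqP; ncring.
have rx : r * x = 1.
  apply/eqP; rewrite -subr_eq0 -[X in _ - X](addrK (r * (1 - x))) hr.
  by apply/eqP; ncring.
apply/unitrP; exists l; split=> //.
by rewrite -[l]mul1r -rx -mulrA xl mulr1.
Qed.

Lemma dist_unit t x : cnorm (sc t - x) < t -> x \is a GRing.unit.
Proof.
move=> h; have t0 : 0 < t by apply: le_lt_trans h; apply: cnorm_ge0.
have u : sc t^-1 * x \is a GRing.unit.
  apply: neumann_unit; rewrite -[1](scVK 1 (lt0r_neq0 t0)) mulr1 -mulrBr.
  by rewrite cnorm_scM gtr0_norm ?invr_gt0 // mulrC ltr_pdivrMr // mul1r.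
have su : sc t \is a GRing.unit.
  by apply/unitrP; exists (sc t^-1); rewrite -scC !scV ?lt0r_neq0.
by rewrite -(scK x (lt0r_neq0 t0)) unitrMr.
Qed.

(** The equation [(1 - v)^2 = 1 - u] is the fixed point equation
    [v = (u + v^2) / 2], a contraction on the ball of radius [|u|]. *)
Lemma sqrt_near1 u : selfadjoint u -> cnorm u < 1 ->
  exists h, [/\ selfadjoint h, h * h = 1 - u &
    forall y, y * u = u * y -> y * h = h * y].
Proof.
move=> us hu; pose q := cnorm u.
have q0 : 0 <= q by apply: cnorm_ge0.
have q01 : 0 <= q < 1 by rewrite q0.
have n2 x : cnorm (sc 2^-1 * x) = cnorm x / 2.
  by rewrite cnorm_scM gtr0_norm ?invr_gt0 // mulrC.
pose F v := sc 2^-1 * (u + v * v).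
have [||v [vq vF vlim]] := @contraction_fixpoint F q q q01 q0.
- move=> x hx; rewrite n2 ler_pdivrMr //.
  have := cnormD_le (lexx (cnorm u)) (cnormM_le hx hx).
  by rewrite -/q in hu *; nra.
- move=> x y hx hy; rewrite -mulrBr n2 ler_pdivrMr //.
  have -> : u + x * x - (u + y * y) = x * (x - y) + (x - y) * y by ncring.
  apply: le_trans (cnormD_le (cnormM_le hx (lexx _)) (cnormM_le (lexx _) hy)) _.
  lra.
have vlim0 (T : A -> A) (K : R) : 0 <= K ->
    (forall x y, T (x - y) = T x - T y) ->
    (forall x, cnorm (T x) <= K * cnorm x) ->
    (forall n, T (iter n F 0) = 0) -> T v = 0.
  move=> K0 TB TK T0; apply: cnorm_small0 => e e0.
  have [|n hn] := vlim (e / (K + 1)); first by rewrite divr_gt0 //; lra.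
  have -> : T v = - T (iter n F 0 - v) by rewrite TB T0 sub0r opprK.
  rewrite cnormN; apply: le_lt_trans (TK _) _.
  rewrite ltr_pdivlMr in hn; last by lra.
  by have := cnorm_ge0 (iter n F 0 - v); lra.
exists (1 - v); split.
- rewrite /selfadjoint starB star1; congr (1 - _).
  apply/eqP; rewrite -subr_eq0; apply/eqP.
  apply: (vlim0 (fun x => star x - x) 2) => //.
  + by move=> x y; rewrite starB; ncring.
  + by move=> x; apply: le_trans (cnormB _ _) _; rewrite cnorm_starE; lra.
  + elim=> [|n IH] /=; first by rewrite star0 subrr.
    rewrite /F starM star_sc starD us starM.
    have -> : star (iter n F 0) = iter n F 0 by apply/eqP; rewrite -subr_eq0 IH.
    by rewrite scC subrr.
- have h2 : v + v = u + v * v.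
    have := congr1 (fun x => sc 2 * x) vF.
    by rewrite /F scK ?pnatr_eq0 // sc2 mulrDl mul1r.
  have -> : (1 - v) * (1 - v) = 1 - (v + v) + v * v by ncring.
  by rewrite h2; ncring.
- move=> y hy; rewrite mulrBr mulrBl mulr1 mul1r; congr (y - _).
  apply/eqP; rewrite -subr_eq0; apply/eqP.
  apply: (vlim0 (fun x => y * x - x * y) (2 * cnorm y)).
  + by rewrite mulr_ge0 ?cnorm_ge0.
  + by move=> a b; ncring.
  + move=> a; apply: le_trans (cnormB _ _) _.
    have := cnormM y a; have := cnormM a y; lra.
  + elim=> [|n IH] /=; first by rewrite mulr0 mul0r subrr.
    set w := iter n F 0 in IH *.
    have {}IH : y * w = w * y by apply/eqP; rewrite -subr_eq0 IH.
    rewrite /F mulrA scC -!mulrA -mulrBr.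
    have -> : y * (u + w * w) - (u + w * w) * y
            = (y * u - u * y) + (y * w - w * y) * w + w * (y * w - w * y) by ncring.
    by rewrite hy IH !subrr mul0r mulr0 !addr0 mulr0.
Qed.

End Banach.
Arguments sc {R A} t.

(** * Positive elements of a C*-algebra *)
Section Positivity.
Variables (R : realType) (A : cstarType R).
Implicit Types (x y z h p : A) (t e : R).

(** Positivity in terms of the norm: for selfadjoint [x], [|t - x| <= t] says
    that the spectrum of [x] lies between [0] and [2 t].  With this definition the
    triangle inequality makes the positive elements a convex cone, and
    positivity is preserved by isometric inclusions; that it amounts to being
    of the form [y^* y] is the content of [pos_sqrt] and [pos_star]. *)
Definition pos x := selfadjoint x /\ exists t, cnorm (sc t - x) <= t.

Definition ii : A := 'i *: 1.

Lemma iiC x : x * ii = ii * x.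
Proof. by rewrite /ii -scalerAl -scalerAr mul1r mulr1. Qed.
Lemma ii2 : ii * ii = - 1.
Proof. by rewrite /ii -scalerAl mul1r scalerA -expr2 sqrCi scaleN1r. Qed.
Lemma conj_i : Num.conj ('i : R[i]) = - 'i.
Proof. by rewrite conjCi. Qed.
Lemma star_ii : star ii = - ii.
Proof. by rewrite /ii starZ star1 conj_i scaleNr. Qed.

Lemma sa0 : selfadjoint (0 : A). Proof. exact: star0. Qed.
Lemma sa_sc t : selfadjoint (sc t : A). Proof. exact: star_sc. Qed.
Lemma saD x y : selfadjoint x -> selfadjoint y -> selfadjoint (x + y).
Proof. by rewrite /selfadjoint starD => -> ->. Qed.
Lemma saN x : selfadjoint x -> selfadjoint (- x).
Proof. by rewrite /selfadjoint starN => ->. Qed.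
Lemma saB x y : selfadjoint x -> selfadjoint y -> selfadjoint (x - y).
Proof. by move=> ? ?; apply: saD => //; apply: saN. Qed.
Lemma saM x y : selfadjoint x -> selfadjoint y -> x * y = y * x ->
  selfadjoint (x * y).
Proof. by rewrite /selfadjoint starM => -> -> ->. Qed.
Lemma saZ t x : selfadjoint x -> selfadjoint (sc t * x).
Proof. by move=> xs; apply: saM => //; rewrite ?scC //; apply: sa_sc. Qed.
Lemma saV x : x \is a GRing.unit -> selfadjoint x -> selfadjoint x^-1.
Proof. by move=> xu xs; rewrite /selfadjoint starV // xs. Qed.
Lemma sa_starM y : selfadjoint (star y * y).
Proof. by rewrite /selfadjoint starM starK. Qed.

Lemma posD x y : pos x -> pos y -> pos (x + y).
Proof.
move=> [xs [s hs]] [ys [t ht]]; split; first exact: saD.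
exists (s + t); rewrite scD.
have -> : sc s + sc t - (x + y) = (sc s - x) + (sc t - y) by ncring.
exact: cnormD_le.
Qed.

Lemma pos_scB x t : selfadjoint x -> cnorm x <= t -> pos (sc t - x).
Proof.
move=> xs xt; split; first by apply: saB => //; apply: sa_sc.
by exists t; rewrite opprB addrC subrK.
Qed.

Lemma pos_scD x t : selfadjoint x -> cnorm x <= t -> pos (sc t + x).
Proof.
move=> xs xt; rewrite -[x]opprK; apply: pos_scB; first exact: saN.
by rewrite cnormN.
Qed.

Lemma pos_sc t : 0 <= t -> pos (sc t : A).
Proof.
move=> t0; rewrite -[sc t]subr0; apply: pos_scB; rewrite ?cnorm0 //.
exact: sa0.
Qed.

Lemma posZ t x : 0 <= t -> pos x -> pos (sc t * x).
Proof.
move=> t0 [xs [s hs]]; split; first exact: saZ.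
by exists (t * s); rewrite scM -mulrBr cnorm_scM ger0_norm // ler_wpM2l.
Qed.

Lemma posZV t x : 0 < t -> pos (sc t * x) -> pos x.
Proof.
move=> t0 h; rewrite -(scVK x (lt0r_neq0 t0)); apply: posZ => //.
by rewrite invr_ge0 ltW.
Qed.

Lemma pos_unit x e : pos x -> 0 < e -> x + sc e \is a GRing.unit.
Proof.
move=> [xs [t ht]] e0; apply: (@dist_unit _ _ (t + e)).
by rewrite scD opprD addrACA subrr addr0; lra.
Qed.

Lemma pos_sqrt x e : pos x -> 0 < e ->
  exists h, [/\ selfadjoint h, h * h = x + sc e &
    forall y, y * x = x * y -> y * h = h * y].
Proof.
move=> [xs [t ht]] e0; pose s := t + e.
have t0 : 0 <= t by apply: le_trans ht; apply: cnorm_ge0.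
have s0 : 0 < s by rewrite /s; lra.
have sN0 := lt0r_neq0 s0.
pose u := sc s^-1 * (sc t - x).
have us : selfadjoint u by apply/saZ/saB => //; apply: sa_sc.
have u1 : cnorm u < 1.
  rewrite cnorm_scM gtr0_norm ?invr_gt0 // mulrC ltr_pdivrMr // mul1r.
  by rewrite /s; lra.
have uE : sc s * (1 - u) = x + sc e.
  by rewrite mulrBr scK // mulr1 /s scD; ncring.
have [h [hs hE hC]] := sqrt_near1 us u1.
exists (sc (Num.sqrt s) * h); split; first exact: saZ.
- rewrite mulrA -(mulrA _ h) scC mulrA -scM -expr2 sqr_sqrtr ?ltW //.
  by rewrite -mulrA hE.
- move=> y yx; rewrite mulrA scC -!mulrA hC //.
  rewrite /u mulrA scC -!mulrA; congr (_ * _).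
  by rewrite mulrBr mulrBl yx scC.
Qed.

(** If [x^2 + h^2 = T] with commuting selfadjoint [x] and [h], then
    [u = x + i h] satisfies [u^* u = T], and [x] is the real part of [u]. *)
Lemma cnorm_pythagoras x h T : selfadjoint x -> selfadjoint h ->
  x * h = h * x -> x * x + h * h = sc T -> cnorm x ^+ 2 <= `|T|.
Proof.
move=> xs hs xh hT; pose u := x + ii * h.
have us : star u = x - ii * h.
  by rewrite starD starM xs hs star_ii mulrN iiC.
have uT : cnorm u ^+ 2 = `|T|.
  rewrite -cnorm_star us -(cnorm_sc A) -hT; congr cnorm.
  have -> : (x - ii * h) * u =
    x * x - (ii * ii) * (h * h) + (x * ii - ii * x) * h + ii * (x * h - h * x)
      + ii * (ii * h - h * ii) * h by rewrite /u; ncring.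
  by rewrite (iiC h) (iiC x) ii2 xh !subrr; ncring.
rewrite -uT lerXn2r ?nnegrE ?cnorm_ge0 //.
have x2 : sc 2 * x = u + star u by rewrite us /u sc2; ncring.
have := cnormD_le (lexx (cnorm u)) (lexx (cnorm (star u))).
by rewrite -x2 cnorm_scM ger0_norm // cnorm_starE; lra.
Qed.

(** If [k^2 = |h|^2 + 1 - h^2], then [|k|^2 <= |h|^2 + 1] by
    [cnorm_pythagoras]. *)
Lemma pos_sqr h : selfadjoint h -> pos (h * h).
Proof.
move=> hs; have hhs : selfadjoint (h * h) by apply: saM.
split=> //; exists (cnorm h ^+ 2 + 1).
have hp : pos (sc (cnorm h ^+ 2) - h * h) by apply: pos_scB => //; rewrite cnorm_sqr.
have [k [ks kE kC]] := pos_sqrt hp ltr01.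
have hk : h * k = k * h by apply: kC; rewrite mulrBl mulrBr scC mulrA.
have -> : sc (cnorm h ^+ 2 + 1) - h * h = k * k by rewrite kE scD; ncring.
rewrite cnorm_sqr //.
have T0 : 0 <= cnorm h ^+ 2 + 1 by rewrite addr_ge0 // sqr_ge0.
rewrite -[leRHS](ger0_norm T0); apply: (cnorm_pythagoras (h := h)) => //.
by rewrite kE scD; ncring.
Qed.

(** With square roots [h], [k] of [t + e - y] and [t + e + y], one has
    [y^2 + (h k)^2 = (t + e)^2]. *)
Lemma cnorm_le_pos y t : 0 <= t -> selfadjoint y -> pos (sc t - y) ->
  pos (sc t + y) -> cnorm y <= t.
Proof.
move=> t0 ys p1 p2; apply/ler_addgt0Pr => e e0.
have [h [hs hE hC]] := pos_sqrt p1 e0.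
have [k [ks kE kC]] := pos_sqrt p2 e0.
have yh : y * h = h * y by apply: hC; rewrite mulrBl mulrBr scC.
have yk : y * k = k * y by apply: kC; rewrite mulrDl mulrDr scC.
have hk : h * k = k * h by apply: kC; rewrite mulrDl mulrDr scC yh.
have te0 : 0 <= t + e by lra.
rewrite -(@ler_sqr R) ?nnegrE ?cnorm_ge0 // -[leRHS]ger0_norm ?sqr_ge0 //.
apply: (cnorm_pythagoras (h := h * k)) => //; first exact: saM.
  by rewrite mulrA yh -!mulrA yk.
have -> : h * k * (h * k) = (h * h) * (k * k).
  by rewrite -mulrA (mulrA k) -hk !mulrA.
have -> : h * h = sc (t + e) - y by rewrite hE scD; ncring.
have -> : k * k = sc (t + e) + y by rewrite kE scD; ncring.
rewrite expr2 scM mulrDr !mulrBl (scC (t + e) y); ncring.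
Qed.

Lemma pos_cnorm_scB x t : pos x -> cnorm x <= t -> cnorm (sc t - x) <= t.
Proof.
move=> xp xt; have [xs _] := xp.
have t0 : 0 <= t by apply: le_trans xt; apply: cnorm_ge0.
apply: cnorm_le_pos => //.
- by apply: saB => //; apply: sa_sc.
- by rewrite opprB addrC subrK.
- by rewrite addrA -scD; apply: pos_scB => //; lra.
Qed.

Lemma pos_closed x : (forall e, 0 < e -> pos (x + sc e)) -> pos x.
Proof.
move=> h; have [xs _] := h 1 ltr01.
have {}xs : selfadjoint x by rewrite -(addrK (sc 1) x); apply: saB => //; apply: sa_sc.
split=> //; exists (cnorm x); apply/ler_addgt0Pr => e e0.
have := @pos_cnorm_scB (x + sc e) (cnorm x + e) (h e e0).
rewrite scD opprD addrACA subrr addr0; apply; apply: cnormD_le => //.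
by rewrite cnorm_sc gtr0_norm.
Qed.

(** The product of square roots of [x + d] and [y + d] is a square root of
    [x y + d (x + y) + d^2]. *)
Lemma posM x y : pos x -> pos y -> x * y = y * x -> pos (x * y).
Proof.
move=> xp yp xy; have [xs _] := xp; have [ys _] := yp.
apply: pos_closed => e e0.
pose M := cnorm x + cnorm y + 1 + e.
(* small enough for [d (|x| + |y|) + d^2 <= e] *)
pose d := e / M.
have nx := cnorm_ge0 x; have ny := cnorm_ge0 y.
have M0 : 0 < M by rewrite /M; lra.
have d0 : 0 < d by rewrite divr_gt0.
have d1 : d <= 1 by rewrite ler_pdivrMr // /M; lra.
have dM : d * M = e by rewrite /d mulfVK // lt0r_neq0.
have [h [hs hE hC]] := pos_sqrt xp d0.
have [k [ks kE kC]] := pos_sqrt yp d0.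
have yh : y * h = h * y by apply: hC.
have hk : h * k = k * h by apply: kC.
have -> : x * y + sc e = h * k * (h * k) + (sc (e - d ^+ 2) - sc d * (x + y)).
  have -> : h * k * (h * k) = (h * h) * (k * k).
    by rewrite -mulrA (mulrA k) -hk !mulrA.
  rewrite hE kE scB expr2 scM !mulrDr !mulrDl (scC d x); ncring.
apply: posD; first by apply/pos_sqr/saM.
apply: pos_scB; first by apply/saZ/saD.
rewrite cnorm_scM gtr0_norm //.
have := cnormD x y; have := cnorm_ge0 (x + y); rewrite /M in dM; nra.
Qed.

Lemma comm_sym x y : x * y = y * x -> y * x = x * y. Proof. by move=> ->. Qed.
Lemma comm_scD x t : x * (x + sc t) = (x + sc t) * x.
Proof. by rewrite mulrDl mulrDr scC. Qed.
Lemma comm_V x y : x * y = y * x -> x * y^-1 = y^-1 * x.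
Proof. exact: commrV. Qed.

Lemma posV p : pos p -> p \is a GRing.unit -> pos p^-1.
Proof.
move=> pp pu; have [ps _] := pp.
have -> : p^-1 = (p^-1 * p^-1) * p by rewrite -mulrA mulVr // mulr1.
apply: posM => //; first by apply/pos_sqr/saV.
by rewrite -mulrA mulVr // mulrA mulrV // mul1r mulr1.
Qed.

(** [p^2 >= d^2] for [d = 1 / |p^-1|], because [p^-2 <= |p^-1|^2]; then divide
    [p^2 - d^2] by [p + d]. *)
Lemma pos_ge_invnorm p : pos p -> p \is a GRing.unit ->
  pos (p - sc (cnorm p^-1)^-1).
Proof.
move=> pp pu; have [ps _] := pp; set r := p^-1; set d := (cnorm r)^-1.
have r0 : 0 < cnorm r by apply: cnormV_gt0.
have d0 : 0 < d by rewrite invr_gt0.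
have rs : selfadjoint r by apply: saV.
have p2 : pos (p * p - sc (d ^+ 2)).
  apply: (@posZV (cnorm r ^+ 2)); first by rewrite exprn_gt0.
  have -> : sc (cnorm r ^+ 2) * (p * p - sc (d ^+ 2)) =
      p * p * (sc (cnorm r ^+ 2) - r * r).
    rewrite !mulrBr (scC _ (p * p)); congr (_ - _).
    rewrite -scM -exprMn mulfV ?lt0r_neq0 // expr1n sc1.
    by rewrite -mulrA (mulrA p r) mulrV // mul1r mulrV.
  apply: posM; first exact: pos_sqr.
    by apply: pos_scB; [apply: saM|rewrite cnorm_sqr].
  rewrite mulrBr mulrBl scC; congr (_ - _).
  by rewrite -!mulrA (mulrA r p) (mulrA p r) mulrV // mulVr // !mul1r mulrV // mulVr.
have qu : p + sc d \is a GRing.unit by apply: pos_unit.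
have qp : pos (p + sc d) by apply: posD => //; apply/pos_sc/ltW.
have pq : p * (p + sc d)^-1 = (p + sc d)^-1 * p by apply/comm_V/comm_scD.
have -> : p - sc d = (p * p - sc (d ^+ 2)) * (p + sc d)^-1.
  have -> : p * p - sc (d ^+ 2) = (p - sc d) * (p + sc d).
    by rewrite expr2 scM mulrBl !mulrDr (scC d p); ncring.
  by rewrite -mulrA mulrV // mulr1.
apply: posM => //; first exact: posV.
by rewrite mulrBl mulrBr scC -mulrA pq !mulrA pq.
Qed.

(** Suppose that [y = |x| - x] has norm [n > |x|].  Then [n - y] is positive and
    invertible, hence at least some [d > 0], and [0 <= y <= n - d] gives
    [|y| < n]. *)
Lemma unit_pos x : selfadjoint x ->
  (forall e, 0 < e -> x + sc e \is a GRing.unit) -> pos x.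
Proof.
move=> xs xu; split=> //; exists (cnorm x); rewrite leNgt; apply/negP.
set y := sc (cnorm x) - x; set n := cnorm y => nx.
have yp : pos y by apply: pos_scB.
have [ys _] := yp.
have zp : pos (sc n - y) by apply: pos_scB.
have zu : sc n - y \is a GRing.unit.
  have -> : sc n - y = x + sc (n - cnorm x) by rewrite /y scB; ncring.
  by apply: xu; rewrite subr_gt0.
have := pos_ge_invnorm zp zu; set d := (_)^-1 => hd.
have d0 : 0 < d by rewrite invr_gt0 cnormV_gt0.
have n0 : 0 < n by apply: le_lt_trans nx; apply: cnorm_ge0.
have hd' : pos (sc (n - Num.min d n) - y).
  have -> : sc (n - Num.min d n) - y =
      (sc n - y - sc d) + sc (d - Num.min d n) by rewrite !scB; ncring.
  by apply: posD => //; apply: pos_sc; rewrite subr_ge0 ge_min lexx.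
have m0 : 0 <= n - Num.min d n by rewrite subr_ge0 ge_min lexx orbT.
have : n <= n - Num.min d n.
  by apply: cnorm_le_pos => //; apply: posD => //; apply: pos_sc.
by rewrite lerDl oppr_ge0 leNgt lt_min d0 n0.
Qed.

(** Invertibility of [t - z^* z] and of [t - z z^*] are equivalent for
    [t > 0]. *)
Lemma pos_scB_flip z t : 0 <= t -> pos (sc t - star z * z) ->
  pos (sc t - z * star z).
Proof.
move=> t0 h; apply: unit_pos.
  by apply: saB; [apply: sa_sc|rewrite -{1}(starK z); apply: sa_starM].
move=> e e0; pose s := t + e.
have s0 : s != 0 by rewrite lt0r_neq0 // /s; lra.
have qu : sc s - star z * z \is a GRing.unit.
  have -> : sc s - star z * z = sc t - star z * z + sc e by rewrite scD; ncring.
  exact: pos_unit.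
have -> : sc t - z * star z + sc e = sc s - z * star z by rewrite scD; ncring.
set q := _ - _ in qu.
have zq : (sc s - z * star z) * z = z * q.
  by rewrite /q mulrBl mulrBr scC mulrA.
have qz : star z * (sc s - z * star z) = q * star z.
  by rewrite /q mulrBl mulrBr scC mulrA.
apply/unitrP; exists (sc s^-1 * (1 + z * q^-1 * star z)); split.
  rewrite -(mulrA (sc s^-1)) mulrDl mul1r -(mulrA (z * _)) qz -(mulrA z).
  by rewrite (mulrA q^-1) mulVr // mul1r subrK -scM mulVf // sc1.
have e1 : (sc s - z * star z) * (1 + z * q^-1 * star z) = sc s.
  by rewrite mulrDr mulr1 !mulrA zq -(mulrA z q) mulrV // mulr1 subrK.
by rewrite mulrA scC -[sc s^-1 * _ * _]mulrA e1 -scM mulVf // sc1.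
Qed.

Lemma pos_symsum z : pos (star z * z + z * star z).
Proof.
apply: (@posZV 2) => //.
have -> : sc 2 * (star z * z + z * star z) =
    (z + star z) * (z + star z) + (ii * (z - star z)) * (ii * (z - star z)).
  rewrite -[ii * (z - star z) * _]mulrA [(z - star z) * _]mulrA iiC.
  by rewrite -!mulrA mulrA ii2 sc2; ncring.
apply: posD; apply: pos_sqr; rewrite /selfadjoint.
  by rewrite starD starK addrC.
by rewrite starM starB starK star_ii mulrN iiC -mulrN opprB.
Qed.

(** Let [p = a + l], [r = p^-1], [z = y r], so that [z^* z = r - l r^2] is at
    most [1 / (4 l)].  Then so is [z z^*], and hence
    [z^* z >= - z z^* >= - t] for [t = 3 / (4 l)], where [t] is chosen such that
    [t p^2 + p - l = t (p - 2 l / 3) (p + 2 l)] has rational roots. *)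
Lemma pos_star_step y l : 0 < l -> pos (star y * y + sc l) ->
  star y * y + sc l \is a GRing.unit -> pos (star y * y + sc (l / 3)).
Proof.
move=> l0 pp pu; set p := star y * y + sc l in pp pu.
have aE : star y * y = p - sc l by rewrite /p addrK.
clearbody p.
have lN0 := lt0r_neq0 l0.
have [ps _] := pp; pose r := p^-1.
have rs : selfadjoint r by apply: saV.
have pr : p * r = 1 by rewrite mulrV.
have rp : r * p = 1 by rewrite mulVr.
pose z := y * r; pose t := 3 / (4 * l).
have t0 : 0 < t by rewrite divr_gt0 // mulr_gt0.
have zz : star z * z = r - sc l * (r * r).
  have -> : star z * z = r * (star y * y) * r by rewrite starM rs !mulrA.
  by rewrite aE mulrBr rp scC mulrBl mul1r mulrA.
have h1 : pos (sc t - star z * z).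
  pose w := r - sc (2 * l)^-1.
  have -> : sc t - star z * z = sc l * (w * w) + sc (2 * l)^-1.
    set k := sc (2 * l)^-1.
    have -> : sc l * (w * w) = sc l * (r * r) - (sc l * k + sc l * k) * r
      - sc l * (r * k - k * r) + sc l * k * k by rewrite /w -/k; ncring.
    rewrite /k (scC _ r) subrr mulr0 subr0 -!scM -scD zz.
    have -> : l * (2 * l)^-1 + l * (2 * l)^-1 = 1 by field.
    have -> : t = l * (2 * l)^-1 * (2 * l)^-1 + (2 * l)^-1 by rewrite /t; field.
    by rewrite sc1 scD; ncring.
  apply: posD; first by apply: posZ; [apply: ltW|apply/pos_sqr/saB => //; apply: sa_sc].
  by apply: pos_sc; rewrite invr_ge0 mulr_ge0 // ltW.
have h2 := pos_scB_flip (ltW t0) h1.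
have h3 : pos (sc t + star z * z).
  have -> : sc t + star z * z =
    (sc t - z * star z) + (star z * z + z * star z) by ncring.
  by apply: posD => //; apply: pos_symsum.
have h4 : pos ((sc t + star z * z) * (p * p)).
  apply: posM => //; first exact: pos_sqr.
  have rpC : r * p = p * r by rewrite rp pr.
  apply: comm_sym; rewrite mulrDl mulrDr scC zz; congr (_ + _).
  rewrite mulrBl mulrBr; congr (_ - _).
    by rewrite -mulrA pr mulr1 mulrA rp mul1r.
  rewrite mulrA scC -!mulrA; congr (_ * _).
  by rewrite !mulrA -(mulrA p p r) -(mulrA r r p) pr rp !mulr1 pr rp.
have {}h4 : pos (sc t * ((p - sc (2 * l / 3)) * (p + sc (2 * l)))).
  move: h4; congr pos; rewrite zz mulrDl mulrBl.
  have -> : r * (p * p) = p by rewrite mulrA rp mul1r.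
  have -> : sc l * (r * r) * (p * p) = sc l.
    by rewrite -!mulrA (mulrA r p) rp mul1r rp mulr1.
  set k := sc (2 * l / 3).
  have -> : sc t * ((p - k) * (p + sc (2 * l))) = sc t * (p * p)
    + (sc t * sc (2 * l) - sc t * k) * p - sc t * k * sc (2 * l)
    + sc t * (p * sc (2 * l) - sc (2 * l) * p) by ncring.
  rewrite /k (scC _ p) subrr mulr0 addr0 -!scM -scB.
  have -> : t * (2 * l) - t * (2 * l / 3) = 1 by rewrite /t; field.
  have -> : t * (2 * l / 3) * (2 * l) = l by rewrite /t; field.
  by rewrite sc1 mul1r; ncring.
have qp : pos (p + sc (2 * l)) by apply: posD => //; apply: pos_sc; lra.
have qu : p + sc (2 * l) \is a GRing.unit by apply: pos_unit => //; lra.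
have {}h4 := posZV t0 h4.
have -> : star y * y + sc (l / 3) = (p - sc (2 * l / 3)) * (p + sc (2 * l)) *
    (p + sc (2 * l))^-1.
  by rewrite -mulrA mulrV // mulr1 aE -!addrA -!scN -scD; congr (_ + sc _); field.
apply: posM => //; first exact: posV.
rewrite -mulrA mulrV // mulr1.
have ppC : p * (p + sc (2 * l)) = (p + sc (2 * l)) * p by apply: comm_scD.
have -> : (p - sc (2 * l / 3)) * (p + sc (2 * l)) =
    (p + sc (2 * l)) * (p - sc (2 * l / 3)) by rewrite mulrBl mulrBr ppC scC.
by rewrite mulrA mulVr // mul1r.
Qed.

(** By iteration of the step, [y^* y + l >= 0] for arbitrarily small [l]. *)
Lemma pos_star y : pos (star y * y).
Proof.
set a := star y * y.
have a_sa : selfadjoint a by apply: sa_starM.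
(* For [a + l >= 0], the element [a + 2 l] is positive and invertible, and the
   step leads to [a + 2 l / 3 >= 0]. *)
have decay n : pos (a + sc (cnorm a * (2 / 3) ^+ n)) \/ a = 0.
  have [a0|a0] := eqVneq a 0; [by right|left].
  have na0 : 0 < cnorm a.
    by rewrite lt_def cnorm_ge0 andbT; apply: contra a0 => /eqP/cnorm_eq0/eqP.
  elim: n => [|n IH]; first by rewrite expr0 mulr1 addrC; apply: pos_scD.
  set l := _ * _ in IH.
  have l0 : 0 < l by rewrite mulr_gt0 // exprn_gt0 // divr_gt0.
  have e1 : a + sc (2 * l) = a + sc l + sc l.
    by rewrite -addrA -scD; congr (_ + sc _); ring.
  have -> : cnorm a * (2 / 3) ^+ n.+1 = (2 * l) / 3 by rewrite exprS /l; field.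
  apply: pos_star_step; first by rewrite mulr_gt0.
  - by rewrite -/a e1; apply: posD => //; apply/pos_sc/ltW.
  - by rewrite -/a e1; apply: pos_unit.
apply: pos_closed => e e0.
have q01 : 0 <= (2 / 3 : R) < 1 by apply/andP; split; lra.
have a1 : 0 < cnorm a + 1 by have := cnorm_ge0 a; lra.
have [|N /(_ N (leqnn _)) hN] := @exp_small R (2 / 3) (e / (cnorm a + 1)) q01.
  by rewrite divr_gt0.
rewrite ltr_pdivlMr // in hN.
case: (decay N) => [h|->]; last by rewrite add0r; apply/pos_sc/ltW.
set l := _ * _ in h.
have le : 0 <= e - l.
  have q0 : 0 <= (2 / 3 : R) ^+ N by apply: exprn_ge0; apply: divr_ge0.
  by rewrite /l; lra.
have -> : a + sc e = a + sc l + sc (e - l) by rewrite scB; ncring.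
by apply: posD => //; apply: pos_sc.
Qed.

End Positivity.

(** * Imaginary parts and half-planes *)
Section PositivityConsequences.
Variables (R : realType) (A : cstarType R).
Implicit Types (x y z b c d : A) (t e : R).

Lemma pos_cpos x : cpos x -> pos x.
Proof. by case=> y ->; apply: pos_star. Qed.

(** The square root of [x + d] reduces this to [pos_star]. *)
Lemma pos_conj x y : pos x -> pos (star y * x * y).
Proof.
move=> xp; apply: pos_closed => e e0.
pose d := e / (cnorm (star y * y) + 1).
have n0 := cnorm_ge0 (star y * y).
have d0 : 0 < d by rewrite divr_gt0 //; lra.
have [h [hs hE _]] := pos_sqrt xp d0.
have -> : star y * x * y + sc e =
    star (h * y) * (h * y) + (sc e - sc d * (star y * y)).
  have -> : star (h * y) * (h * y) = star y * (h * h) * y.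
    by rewrite starM hs !mulrA.
  by rewrite hE mulrDr mulrDl scC; ncring.
apply: posD; first exact: pos_star.
apply: pos_scB; first by apply/saZ/sa_starM.
rewrite cnorm_scM gtr0_norm // /d mulrAC ler_pdivrMr; last by lra.
nra.
Qed.

Lemma pos_conjr x y : pos x -> pos (y * x * star y).
Proof. by move=> xp; rewrite -{1}(starK y); apply: pos_conj. Qed.

Lemma cnorm_le_sc x t : 0 <= t -> pos x -> pos (sc t - x) -> cnorm x <= t.
Proof.
move=> t0 xp h; apply: cnorm_le_pos => //; first by case: xp.
by apply: posD => //; apply: pos_sc.
Qed.

Lemma cnorm_mono x y : pos x -> pos (y - x) -> cnorm x <= cnorm y.
Proof.
move=> xp h; apply: cnorm_le_sc => //; first exact: cnorm_ge0.
have -> : sc (cnorm y) - x = (sc (cnorm y) - y) + (y - x) by ncring.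
apply: posD => //; apply: pos_scB => //.
by rewrite -(subrK x y); have [? _] := xp; have [? _] := h; apply: saD.
Qed.

Lemma inv_2i : (2 * 'i : R[i])^-1 = 2^-1%:C * - 'i.
Proof.
have i0 : ('i : R[i]) != 0 by exact: neq0Ci.
apply: (mulfI (x := 2 * 'i)); first by rewrite mulf_neq0 // pnatr_eq0.
rewrite mulfV ?mulf_neq0 ?pnatr_eq0 //.
rewrite mulrACA mulrN -expr2 sqrCi opprK mulr1.
have -> : (2 : R[i]) = 2%:C by rewrite rmorph_nat.
by rewrite -rmorphM mulfV ?pnatr_eq0.
Qed.

Lemma imagE b : imag b = sc 2^-1 * (ii A * (star b - b)).
Proof.
rewrite /imag [X in X *: _](_ : _ = 2^-1%:C * - 'i); last exact: inv_2i.
rewrite -scalerA scE; congr (_ * _).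
by rewrite scaleNr -scalerN opprB /ii -scalerAl mul1r.
Qed.

Lemma sc2_imag b : sc 2 * imag b = ii A * (star b - b).
Proof. by rewrite imagE scK ?pnatr_eq0. Qed.

Lemma imag_eq b c : ii A * (star b - b) = sc 2 * c -> imag b = c.
Proof.
rewrite -sc2_imag => /(congr1 (fun x => sc 2^-1 * x)).
by rewrite !scVK ?pnatr_eq0.
Qed.

Lemma imagB b c : imag (b - c) = imag b - imag c.
Proof.
by apply: imag_eq; rewrite [in RHS]mulrBr !sc2_imag starB; ncring.
Qed.
Lemma imagN b : imag (- b) = - imag b.
Proof. by apply: imag_eq; rewrite mulrN !sc2_imag starN; ncring. Qed.
Lemma sa_imag b : selfadjoint (imag b).
Proof.
rewrite imagE; apply: saZ.
by rewrite /selfadjoint starM starB starK star_ii mulrN iiC -mulrN opprB.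
Qed.
Lemma imag_sa b : selfadjoint b -> imag b = 0.
Proof. by move=> bs; rewrite imagE bs subrr !mulr0. Qed.
Lemma imag_iisc t : imag (ii A * sc t) = sc t.
Proof.
apply: imag_eq; rewrite starM star_sc star_ii mulrN -(scC _ (ii A)).
have -> : ii A * (- (ii A * sc t) - ii A * sc t) =
  - (ii A * ii A) * (1 + 1) * sc t by ncring.
by rewrite ii2 sc2; ncring.
Qed.
Lemma imag_conj b y : imag (star y * b * y) = star y * imag b * y.
Proof.
apply: imag_eq.
have -> : sc 2 * (star y * imag b * y) = star y * (sc 2 * imag b) * y.
  by rewrite !mulrA scC.
by rewrite sc2_imag (mulrA (star y)) iiC !starM starK; ncring.
Qed.
Lemma imag_conjr b y : imag (y * b * star y) = y * imag b * star y.
Proof. by have := imag_conj b (star y); rewrite starK. Qed.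
Lemma imag_star b : imag (star b) = - imag b.
Proof. by apply: imag_eq; rewrite mulrN sc2_imag starK; ncring. Qed.
Lemma cnorm_ii x : cnorm (ii A * x) = cnorm x.
Proof. by rewrite /ii -scalerAl mul1r cnormZ [normc _]normc_i mul1r. Qed.
Lemma cnorm_imag b : cnorm (imag b) <= cnorm b.
Proof.
rewrite imagE cnorm_scM cnorm_ii gtr0_norm ?invr_gt0 //.
by have := cnormB (star b) b; rewrite cnorm_starE; lra.
Qed.

Lemma imag_invl c : c \is a GRing.unit ->
  imag c^-1 = - (star c^-1 * imag c * c^-1).
Proof.
move=> cu; rewrite -imag_conj -imagN -mulrA mulrV // mulr1.
by rewrite imagN imag_star opprK.
Qed.
Lemma imag_invr c : c \is a GRing.unit ->
  imag c^-1 = - (c^-1 * imag c * star c^-1).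
Proof.
move=> cu; rewrite -imag_conjr -imagN mulVr // mul1r.
by rewrite imagN imag_star opprK.
Qed.

(** Write [c = d + i e] with [Im d >= 0]; then
    [c^* c = d^* d + 2 e Im d + e^2 >= e^2], and likewise for [c c^*]. *)
Lemma imag_ge_unit c e : 0 < e -> pos (imag c - sc e) ->
  c \is a GRing.unit /\ cnorm c^-1 <= e^-1.
Proof.
move=> e0 cp; pose J := ii A * sc e; pose d := c - J.
have JC x : x * J = J * x by rewrite /J mulrA iiC -!mulrA scC.
have sJ : star J = - J by rewrite /J starM star_sc star_ii mulrN -(scC _ (ii A)).
have JJ : J * J = - sc (e ^+ 2).
  by rewrite {2}/J mulrA iiC /J mulrA ii2 mulN1r mulNr -scM -expr2.
have Jd : J * (star d - d) = sc (2 * e) * (imag c - sc e).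
  have -> : imag c - sc e = imag d by rewrite /d imagB imag_iisc.
  by rewrite mulrC scM -mulrA sc2_imag mulrA /J scC.
clearbody J.
have dp : pos (J * (star d - d)).
  by rewrite Jd; apply: posZ => //; rewrite mulr_ge0 // ltW.
have cE : c = d + J by rewrite /d subrK.
have csE : star c = star d - J by rewrite cE starD sJ.
have c1 : pos (star c * c - sc (e ^+ 2)).
  have -> : star c * c - sc (e ^+ 2) =
      star d * d + J * (star d - d) + (star d * J - J * star d) - (J * J + sc (e ^+ 2)).
    by rewrite csE cE; ncring.
  rewrite JC subrr JJ addNr subr0 addr0; apply: posD => //.
  exact: pos_star.
have c2 : pos (c * star c - sc (e ^+ 2)).
  have -> : c * star c - sc (e ^+ 2) =
      d * star d + J * (star d - d) - (d * J - J * d) - (J * J + sc (e ^+ 2)).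
    by rewrite csE cE; ncring.
  rewrite JC subrr JJ addNr !subr0; apply: posD => //.
  by rewrite -{1}(starK d); apply: pos_star.
have e20 : 0 < e ^+ 2 by rewrite exprn_gt0.
have u1 : star c * c \is a GRing.unit.
  by rewrite -(subrK (sc (e ^+ 2)) (star c * c)); apply: pos_unit.
have u2 : c * star c \is a GRing.unit.
  by rewrite -(subrK (sc (e ^+ 2)) (c * star c)); apply: pos_unit.
have cu : c \is a GRing.unit.
  have h1 : (star c * c)^-1 * star c * c = 1 by rewrite -mulrA mulVr.
  have h2 : c * (star c * (c * star c)^-1) = 1 by rewrite mulrA mulrV.
  apply/unitrP; exists (star c * (c * star c)^-1); split=> //.
  by rewrite -[X in X * c]mul1r -{1}h1 -(mulrA _ c) h2 mulr1 h1.
split=> //; set r := c^-1.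
have := pos_conj r c1.
have -> : star r * (star c * c - sc (e ^+ 2)) * r =
    sc 1 - sc (e ^+ 2) * (star r * r).
  rewrite mulrBr mulrBl !mulrA -starM mulrV // star1 mul1r mulrV //.
  by rewrite scC sc1.
move=> h; have := cnorm_le_sc ler01 _ h.
rewrite cnorm_scM gtr0_norm // cnorm_star -exprMn.
move=> /(_ (posZ (ltW e20) (pos_star r))) h1.
have : e * cnorm r <= 1.
  rewrite -(@ler_sqr R) ?nnegrE ?expr1n //.
  by apply: mulr_ge0; [apply: ltW|apply: cnorm_ge0].
by rewrite -[e^-1]mul1r ler_pdivlMr // mulrC.
Qed.

(** [y y^*] is positive and invertible, hence bounded below by a positive
    number. *)
Lemma conj_lower x y e : y \is a GRing.unit -> 0 < e -> pos (x - sc e) ->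
  exists2 d, 0 < d & pos (y * x * star y - sc d).
Proof.
move=> yu e0 xp; set d := (cnorm (y * star y)^-1)^-1.
have yyu : y * star y \is a GRing.unit by rewrite unitrMr ?star_unit.
have yyp : pos (y * star y) by rewrite -{1}(starK y); apply: pos_star.
exists (e * d); first by rewrite mulr_gt0 // invr_gt0 cnormV_gt0.
have -> : y * x * star y - sc (e * d) =
    y * (x - sc e) * star y + sc e * (y * star y - sc d).
  by rewrite mulrBr mulrBl scC -(mulrA (sc e)) scM; ncring.
by apply: posD; [apply: pos_conjr|apply: posZ; [apply: ltW|apply: pos_ge_invnorm]].
Qed.

Lemma upper_halfP b : upper_half b ->
  0 < cnorm (imag b)^-1 /\ pos (imag b - sc (cnorm (imag b)^-1)^-1).
Proof.
case=> e e0 /pos_cpos bp; rewrite -/(sc e) in bp.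
have bp' : pos (imag b).
  by rewrite -(subrK (sc e) (imag b)); apply: posD => //; apply/pos_sc/ltW.
have bu : imag b \is a GRing.unit.
  by rewrite -(subrK (sc e) (imag b)); apply: pos_unit.
by split; [apply: cnormV_gt0|apply: pos_ge_invnorm].
Qed.

Lemma sa_decomp x : exists2 u, selfadjoint u & x = u + 'i *: imag x.
Proof.
exists (sc 2^-1 * (x + star x)).
  by apply: saZ; rewrite /selfadjoint starD starK addrC.
have -> : 'i *: imag x = ii A * imag x by rewrite /ii -scalerAl mul1r.
rewrite imagE mulrA scC -mulrA -mulrDr (mulrA (ii A)) ii2.
have -> : x + star x + - 1 * (star x - x) = (1 + 1) * x by ncring.
by rewrite -sc2 scVK ?pnatr_eq0.
Qed.

Lemma linear_star (B : cstarType R) (T : {linear A -> B}) :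
  (forall x, selfadjoint x -> selfadjoint (T x)) ->
  forall x, T (star x) = star (T x).
Proof.
move=> h x; have [u us xE] := sa_decomp x.
rewrite xE; move: (imag x) (sa_imag x) => v vs.
rewrite starD starZ us vs !linearD !linearZ /= starD starZ.
by rewrite (h _ us) (h _ vs).
Qed.

End PositivityConsequences.

(** * The conditional expectation and resolvents *)
Section Expectation.
Variables (R : realType) (A B : cstarType R) (P : cstar_prob_space A B).
Implicit Types (x y : A) (b : B).
Local Notation j := (incl P).
Local Notation E := (expect P).

Lemma incl_sc t : j (sc t) = sc t.
Proof. by rewrite /sc linearZ rmorph1. Qed.
Lemma incl_ii : j (ii B) = ii A.
Proof. by rewrite /ii linearZ rmorph1. Qed.
Lemma incl_sa b : selfadjoint b -> selfadjoint (j b).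
Proof. by move=> bs; rewrite /selfadjoint -incl_star bs. Qed.
Lemma incl_pos b : pos b -> pos (j b).
Proof.
move=> [bs [t ht]]; split; first exact: incl_sa.
by exists t; rewrite -incl_sc -rmorphB incl_norm.
Qed.
Lemma incl_imag b : imag (j b) = j (imag b).
Proof. by rewrite !imagE !rmorphM /= incl_sc incl_ii rmorphB /= incl_star. Qed.

Lemma E_Ml b x : E (j b * x) = b * E x.
Proof. by have := expect_bimod P b x 1; rewrite rmorph1 !mulr1. Qed.
Lemma E_Mr x b : E (x * j b) = E x * b.
Proof. by have := expect_bimod P 1 x b; rewrite rmorph1 !mul1r. Qed.
Lemma E_sc t : E (sc t) = sc t.
Proof. by rewrite -incl_sc expect_incl. Qed.
Lemma E_pos x : pos x -> pos (E x).
Proof.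
move=> xp; apply: pos_closed => e e0.
have [h [hs hE _]] := pos_sqrt xp e0.
rewrite -(E_sc e) -linearD -hE; apply/pos_cpos/expect_pos.
by exists h; rewrite hs.
Qed.
Lemma E_star x : E (star x) = star (E x).
Proof.
apply: linear_star => {}x xs.
have [h _] := E_pos (pos_scD xs (lexx _)).
move: h; rewrite linearD E_sc => h.
rewrite -[E x](addKr (sc (cnorm x))); apply: saD => //.
exact/saN/sa_sc.
Qed.
Lemma E_imag x : imag (E x) = E (imag x).
Proof.
rewrite !imagE -(incl_sc 2^-1) E_Ml -incl_ii E_Ml.
by rewrite -E_star -linearB.
Qed.

(** Kadison's inequality, by expansion of [E((x - E x)^* (x - E x)) >= 0]. *)
Lemma E_kadison x : pos (E (star x * x) - star (E x) * E x).
Proof.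
have := E_pos (pos_star (x - j (E x))).
rewrite starB -incl_star mulrBl !mulrBr !linearB /= !E_Ml !E_Mr expect_incl.
by rewrite E_star; congr pos; ncring.
Qed.

(** [E(x)^* E(x) <= E(x^* x) <= |x|^2]. *)
Lemma cnorm_E x : cnorm (E x) <= cnorm x.
Proof.
have h : pos (sc (cnorm x ^+ 2) - star (E x) * E x).
  have -> : sc (cnorm x ^+ 2) - star (E x) * E x =
      E (sc (cnorm x ^+ 2) - star x * x) + (E (star x * x) - star (E x) * E x).
    by rewrite linearB E_sc; ncring.
  apply: posD; last exact: E_kadison.
  by apply/E_pos/pos_scB; [apply: sa_starM|rewrite cnorm_star].
have := cnorm_le_sc (sqr_ge0 _) (pos_star (E x)) h.
by rewrite cnorm_star ler_sqr ?nnegrE ?cnorm_ge0.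
Qed.

Variables (s : A) (ss : selfadjoint s).

Definition resolvent (c : B) : A := (j c - s)^-1.

Lemma res_unit c e : 0 < e -> pos (imag c - sc e) ->
  j c - s \is a GRing.unit /\ cnorm (resolvent c) <= e^-1.
Proof.
move=> e0 cp; apply: imag_ge_unit => //.
by rewrite imagB (imag_sa ss) subr0 incl_imag -incl_sc -rmorphB; apply: incl_pos.
Qed.

End Expectation.

(** * Adjacent blocks of noncrossing pairings *)
Section AdjacentBlocks.
Variables (k : nat) (p : 'I_k.+1).
Implicit Types (i : 'I_k.+2) (V W : {set 'I_k.+2}) (pi : {set {set 'I_k.+2}}).

Lemma in_adjacent i : (i \in adjacent p) = (i == p :> nat) || (i == p.+1 :> nat).
Proof.
by rewrite !inE -!val_eqE /= /bump leqNgt ltn_ord.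
Qed.

Lemma val_skip (j : 'I_k) : skip p j = (if (j < p)%N then j : nat else j.+2) :> nat.
Proof. by rewrite /= /bump; case: ltnP => /=; lia. Qed.

Lemma skip_inj : injective (@skip k p).
Proof. by move=> i j /lift_inj /lift_inj. Qed.

Lemma skip_lt (i j : 'I_k) : (skip p i < skip p j)%N = (i < j)%N.
Proof. by rewrite !val_skip; case: (ltnP i p); case: (ltnP j p); lia. Qed.

Lemma skipN (j : 'I_k) : skip p j \notin adjacent p.
Proof. by rewrite in_adjacent val_skip; case: ltnP; lia. Qed.

Lemma skip_onto i : i \notin adjacent p -> exists j, i = skip p j.
Proof.
rewrite in_adjacent negb_or => /andP[h1 h2]; have hi := ltn_ord i; have hp := ltn_ord p.
have [ip|pi] := ltnP i p.
  have ik : (i < k)%N by lia.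
  by exists (Ordinal ik); apply: ord_inj; rewrite val_skip /= ip.
have ik : (i.-2 < k)%N by lia.
exists (Ordinal ik); apply: ord_inj; rewrite val_skip /=.
by have -> : (i.-2 < p)%N = false; lia.
Qed.

(** The inverse of [remove_adjacent] on the pairings with block [{p, p + 1}]. *)
Definition insert_adjacent (pi' : {set {set 'I_k}}) : {set {set 'I_k.+2}} :=
  adjacent p |: [set skip p @: (V' : {set 'I_k}) | V' in pi'].

Lemma adjacentN (pi' : {set {set 'I_k}}) :
  adjacent p \notin [set skip p @: (V' : {set 'I_k}) | V' in pi'].
Proof.
apply/imsetP => -[V' _ E].
have : lift ord0 p \in adjacent p by rewrite !inE eqxx orbT.
by rewrite E => /imsetP[j _ e]; have := skipN j; rewrite -e !inE eqxx orbT.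
Qed.

Lemma skip_imsetK (V : {set 'I_k}) : skip p @^-1: (skip p @: V) = V.
Proof. by apply/setP => j; rewrite inE (mem_imset _ _ skip_inj). Qed.

Lemma insert_adjacentK (pi' : {set {set 'I_k}}) :
  remove_adjacent p (insert_adjacent pi') = pi'.
Proof.
rewrite /remove_adjacent /insert_adjacent setU1K ?adjacentN // -imset_comp.
rewrite -[RHS]imset_id; apply: eq_in_imset => V' _ /=; exact: skip_imsetK.
Qed.

End AdjacentBlocks.

Section NonCrossing.

(** Noncrossing pairings in terms of the points of their blocks. *)
Record nc_pairing k (pi : {set {set 'I_k}}) : Prop := NCPairing {
  nc_card : forall V, V \in pi -> #|V| = 2%N;
  nc_cover : forall i, exists2 V, V \in pi & i \in V;
  nc_eq : forall V W i, V \in pi -> W \in pi -> i \in V -> i \in W -> V = W;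
  nc_cross : forall V W i j i' j', V \in pi -> W \in pi -> V != W ->
    i \in V -> j \in W -> i' \in V -> j' \in W ->
    (i < j)%N -> (j < i')%N -> (i' < j')%N -> False }.

Lemma NC2P k (pi : {set {set 'I_k}}) : reflect (nc_pairing pi) (pi \in NC2 k).
Proof.
rewrite inE /pairing /noncrossing; apply: (iffP idP).
  move=> /andP[/andP[/and3P[/eqP cov tr _] /forall_inP cd] /forall_inP nc]; split.
  - by move=> V /cd /eqP.
  - move=> i; have : i \in cover pi by rewrite cov inE.
    by move=> /bigcupP[V Vpi iV]; exists V.
  - move=> V W i Vpi Wpi iV iW; apply/eqP; apply: contraT => VW.
    by have := trivIsetP tr V W Vpi Wpi VW => /disjoint_setI0/setP/(_ i); rewrite !inE iV iW.
  - move=> V W i j i' j' Vpi Wpi VW iV jW i'V j'W h1 h2 h3.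
    have /forall_inP/(_ W Wpi)/implyP/(_ VW)/negP := nc V Vpi; apply.
    apply/exists_inP; exists i => //; apply/exists_inP; exists j => //.
    apply/exists_inP; exists i' => //; apply/exists_inP; exists j' => //.
    by rewrite h1 h2.
case=> cd cov eqV cr; apply/andP; split; first apply/andP; first split.
- apply/and3P; split.
  + apply/eqP/setP => i; rewrite inE; apply/bigcupP.
    by have [V Vpi iV] := cov i; exists V.
  + apply/trivIsetP => V W Vpi Wpi VW; rewrite -setI_eq0.
    apply/eqP/setP => i; rewrite !inE; apply/negP => /andP[iV iW].
    by move/eqP: VW; apply; apply: eqV iV iW.
  + by apply/negP => /cd; rewrite cards0.
- by apply/forall_inP => V /cd ->.
- apply/forall_inP => V Vpi; apply/forall_inP => W Wpi; apply/implyP => VW.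
  apply/negP => /exists_inP[i iV] /exists_inP[j jW] /exists_inP[i' i'V].
  move=> /exists_inP[j' j'W] /and3P[h1 h2 h3].
  exact: cr Vpi Wpi VW iV jW i'V j'W h1 h2 h3.
Qed.

Lemma insert_nc k (p : 'I_k.+1) (pi' : {set {set 'I_k}}) :
  (insert_adjacent p pi' \in NC2 k.+2) = (pi' \in NC2 k).
Proof.
have skipin V' : V' \in pi' -> skip p @: V' \in insert_adjacent p pi'.
  by move=> h; rewrite !inE; apply/orP; right; apply: imset_f.
have adjin : adjacent p \in insert_adjacent p pi' by rewrite !inE eqxx.
have insP V : V \in insert_adjacent p pi' ->
    V = adjacent p \/ exists2 V', V' \in pi' & V = skip p @: V'.
  rewrite in_setU1 => /orP[/eqP->|/imsetP[V' h ->]]; first by left.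
  by right; exists V'.
have notadj (j : 'I_k) V' : skip p j \in adjacent p -> V' = set0 :> {set 'I_k}.
  by move=> h; have := skipN p j; rewrite h.
apply/NC2P/NC2P => -[cd cov eqV cr]; split.
- by move=> V' /skipin/cd; rewrite card_imset //; apply: skip_inj.
- move=> j; have [V /insP[->|[V' h ->]]] := cov (skip p j).
    by rewrite (negbTE (skipN p j)).
  by rewrite (mem_imset _ _ (@skip_inj _ p)) => jV'; exists V'.
- move=> V' W' i hV hW iV iW; apply: (imset_inj (@skip_inj _ p)).
  by apply: (eqV _ _ (skip p i)); rewrite ?skipin // imset_f.
- move=> V' W' i j i' j' hV hW VW iV jW iV' jW' h1 h2 h3.
  apply: (cr (skip p @: V') (skip p @: W') (skip p i) (skip p j) (skip p i') (skip p j'));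
    rewrite ?skipin ?imset_f ?skip_lt //.
  by apply: contraNN VW => /eqP /(imset_inj (@skip_inj _ p)) ->.
- move=> V /insP[->|[V' h ->]]; last by rewrite card_imset ?cd //; apply: skip_inj.
  by rewrite cards2 -val_eqE /= /bump leqNgt ltn_ord /= neq_ltn; lia.
- move=> i; have [ia|/skip_onto[j ->]] := boolP (i \in adjacent p).
    by exists (adjacent p).
  by have [V' h jV] := cov j; exists (skip p @: V'); rewrite ?skipin ?imset_f.
- move=> V W i /insP[->|[V' hV ->]] /insP[->|[W' hW ->]] //.
  + by move=> h1 /imsetP[j _ e]; move: h1; rewrite e (negbTE (skipN _ _)).
  + by move=> /imsetP[j _ ->]; rewrite (negbTE (skipN _ _)).
  + move=> /imsetP[j jV ->]; rewrite (mem_imset _ _ (@skip_inj _ p)) => jW.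
    by rewrite (eqV V' W' j).
- move=> V W i j i' j' /insP[->|[V' hV ->]] /insP[->|[W' hW ->]] VW.
  + by rewrite eqxx in VW.
  + by rewrite !in_adjacent => ? _ ? _; lia.
  + by rewrite !in_adjacent => _ ? _ ?; lia.
  + move=> /imsetP[a aV ->] /imsetP[b bW ->] /imsetP[c cV ->] /imsetP[d dW ->].
    rewrite !skip_lt; apply: cr aV bW cV dW => //.
    by apply: contraNN VW => /eqP ->.
Qed.

Lemma remove_adjacentK k (p : 'I_k.+1) (pi : {set {set 'I_k.+2}}) :
  pi \in NC2 k.+2 -> adjacent p \in pi ->
  insert_adjacent p (remove_adjacent p pi) = pi.
Proof.
move=> /NC2P[cd cov eqV cr] ap; rewrite /insert_adjacent /remove_adjacent -imset_comp.
rewrite -[RHS](setD1K ap) -[X in _ = _ |: X]imset_id; congr (_ |: _).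
apply: eq_in_imset => V; rewrite in_setD1 => /andP[Va Vpi] /=.
apply/setP => i; apply/imsetP/idP => [[j]|iV]; first by rewrite inE => h ->.
have [ia|/skip_onto[j ij]] := boolP (i \in adjacent p).
  by move/eqP: Va; case; apply: eqV iV ia.
by exists j; rewrite // inE -ij.
Qed.

(** A pair [{i, m}] whose larger element [m] is minimal has [i = m - 1]:
    otherwise the partner of [m - 1] would be larger than [m], and the two
    blocks would cross. *)
Lemma nc_has_adjacent k (pi : {set {set 'I_k.+2}}) :
  pi \in NC2 k.+2 -> exists q, adjacent q \in pi.
Proof.
move=> /NC2P[cd cov eqV cr].
pose closer (m : nat) := [exists V in pi, exists i in V, exists i' in V,
  (i < i')%N && (nat_of_ord i' == m)].
have pairP V : V \in pi -> exists i i' : 'I_k.+2, [/\ (i < i')%N & V = [set i; i']].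
  move=> /cd /eqP /cards2P[x [y [xy ->]]].
  have := xy; rewrite -val_eqE neq_ltn => /orP[h|h]; first by exists x, y.
  by exists y, x; rewrite setUC.
have closerI V (i i' : 'I_k.+2) : V \in pi -> i \in V -> i' \in V -> (i < i')%N -> closer i'.
  move=> h1 h2 h3 h4; apply/exists_inP; exists V => //.
  by apply/exists_inP; exists i => //; apply/exists_inP; exists i' => //; rewrite h4 eqxx.
have exC : exists m, closer m.
  have [V Vpi _] := cov ord0; have [i [i' [ii' VE]]] := pairP V Vpi.
  by exists i'; apply: (closerI V i i') => //; rewrite VE !inE eqxx ?orbT.
case: (ex_minnP exC) => m /exists_inP[V Vpi].
move=> /exists_inP[i iV] /exists_inP[i' i'V] /andP[ii' /eqP mE] mmin.
have VE : V = [set i; i'].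
  have [a [b [ab E]]] := pairP V Vpi; move: iV i'V ii'; rewrite E !inE -!val_eqE /=.
  move=> /orP[] /eqP e1 /orP[] /eqP e2 h; try (exfalso; lia).
  by rewrite (ord_inj e1) (ord_inj e2).
have hm : (i'.-1 < k.+1)%N by have := ltn_ord i'; lia.
exists (Ordinal hm).
have [e|ne] := eqVneq (nat_of_ord i) i'.-1.
  suff <- : V = adjacent (Ordinal hm) by [].
  by apply/setP => x; rewrite in_adjacent VE !inE -!val_eqE /= e prednK //; lia.
have hl : (i'.-1 < k.+2)%N by lia.
pose h := Ordinal hl; have [W Wpi hW] := cov h.
have VW : V != W.
  apply: contraNN ne => /eqP E; move: hW; rewrite -E VE !inE -!val_eqE /=; lia.
have [a [b [ab WE]]] := pairP W Wpi.
exfalso; move: hW; rewrite WE !inE -!val_eqE /= => /orP[|] /eqP hE; last first.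
  have := mmin _ (closerI W a b Wpi _ _ ab); rewrite WE !inE !eqxx orbT => /(_ isT isT).
  by rewrite -mE /=; lia.
have bi' : nat_of_ord b != i'.
  apply: contraNN VW => /eqP/ord_inj e; apply/eqP; apply: (eqV V W b) => //.
    by rewrite e.
  by rewrite WE !inE eqxx orbT.
apply: (cr V W i a i' b) => //; rewrite ?WE ?inE ?eqxx ?orbT //;
  by move: ne bi' => /eqP ? /eqP ?; lia.
Qed.

(** The pairings in which the points [0, ..., p - 1] are all smaller than their
    partners; for those in [NC2 k] with [k > 0] this says that there is no
    adjacent block before [{p - 1, p}]. *)
Definition opening k (p : nat) : {set {set 'I_k}} -> bool :=
  match k with
  | k'.+2 => fun pi => [forall q : 'I_k'.+1, (adjacent q \in pi) ==> (p <= q.+1)%N]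
  | _ => fun _ => p == 0%N
  end.

Lemma skip_adjacent k (p : 'I_k.+3) (q' : 'I_k.+1) (q : 'I_k.+3) :
  q' = q :> nat -> (q.+1 < p)%N -> skip p @: adjacent q' = adjacent q.
Proof.
move=> e h; apply/setP => i; rewrite in_adjacent; apply/imsetP/idP => [[j]|].
  by rewrite in_adjacent => hj ->; rewrite val_skip; case: (ltnP j p); lia.
move=> hi; have hi' : (i < k.+2)%N by have := ltn_ord q'; lia.
exists (Ordinal hi'); first by rewrite in_adjacent /= e.
by apply: ord_inj; rewrite val_skip /=; case: (ltnP i p); lia.
Qed.

(** Insertion does not move the adjacent blocks before [{p - 1, p}], and it
    separates the points [p - 1] and [p]. *)
Lemma insert_opening k (p : 'I_k.+1) (pi' : {set {set 'I_k}}) :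
  pi' \in NC2 k ->
  opening p.+1 (insert_adjacent p pi') = opening p pi'.
Proof.
case: k p pi' => [|[|k]] p pi' h.
- rewrite /= (ord1 p) eqxx; apply/forallP => q; by rewrite (ord1 q) implybT.
- have /NC2P[cd cov _ _] := h; have [V /cd cV _] := cov ord0.
  by have := max_card V; rewrite cV card_ord.
have adjE (V' : {set 'I_k.+2}) q : skip p @: V' = adjacent q -> (q < p)%N -> (q.+1 < p)%N.
  move=> E qp; rewrite ltn_neqAle qp andbT; apply/eqP => e.
  have : lift ord0 q \in adjacent q by rewrite !inE eqxx orbT.
  rewrite -E => /imsetP[j _ hj].
  by have := skipN p j; rewrite -hj in_adjacent /= /bump /= add1n e eqxx.
apply/forallP/forallP => H q; apply/implyP.
  move=> aq; rewrite leqNgt; apply/negP => qp.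
  have hq : (q < k.+3)%N by have := ltn_ord q; lia.
  have /implyP := H (Ordinal hq); rewrite -(@skip_adjacent _ p q) //.
  rewrite in_setU1 imset_f ?orbT // => /(_ isT) /=; lia.
rewrite in_setU1 => /orP[/eqP E|/imsetP[V' hV' E]].
  have : lift ord0 q \in adjacent q by rewrite !inE eqxx orbT.
  have : lift ord_max q \in adjacent q by rewrite !inE eqxx.
  by rewrite E !in_adjacent /= /bump /= add1n; have := ltn_ord q; rewrite ltnS leqNgt; lia.
rewrite leqNgt; apply/negP => qp.
have q1p : (q.+1 < p)%N by apply: (adjE V') => //; lia.
have hq : (q < k.+1)%N by have := ltn_ord p; lia.
have V'E : V' = adjacent (Ordinal hq).
  by apply: (imset_inj (@skip_inj _ p)); rewrite -E (@skip_adjacent _ p _ q).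
by have /implyP := H (Ordinal hq); rewrite -V'E hV' => /(_ isT) /=; lia.
Qed.

(** [pick] takes the head of the enumeration of ['I_n], which is increasing;
    hence [eta_pairing] always removes the leftmost adjacent block. *)
Lemma pick_ord_min n (Q : pred 'I_n) (p : 'I_n) : Q p ->
  (forall q, Q q -> (p <= q)%N) -> [pick q | Q q] = Some p.
Proof.
move=> Qp pmin.
have srt : sorted ltn (map val (enum Q)).
  have -> : enum Q = filter Q (enum 'I_n).
    by rewrite /enum_mem -filter_predI; apply: eq_filter => x; rewrite /= andbT.
  rewrite sorted_map; apply: sorted_filter; first by move=> a b c /=; apply: ltn_trans.
  by rewrite -sorted_map val_enum_ord iota_ltn_sorted.
have pin : p \in enum Q by rewrite mem_enum.
rewrite /pick; case E : (enum Q) pin srt => [//|q r] pin srt /=.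
have Qq : Q q by have : q \in enum Q by [rewrite E mem_head]; rewrite mem_enum.
move: pin; rewrite in_cons => /orP[/eqP -> //|pr].
have /allP/(_ (val p)) := order_path_min ltn_trans srt.
by rewrite map_f // => /(_ isT) /=; have := pmin q Qq; lia.
Qed.

End NonCrossing.

(** * Recursion for sums over noncrossing pairings *)
Section PairingSums.
Variables (R : realType) (B : cstarType R) (eta : {linear B -> B}).
Implicit Types (b : nat -> B) (k p : nat).

(** For [p = 0] these are the moments of the semicircular element. *)
Definition psum k p b : B :=
  \sum_(pi in NC2 k | opening p pi) eta_pairing eta pi b.

Lemma eq_contract p b b' : b =1 b' -> contract eta p b =1 contract eta p b'.
Proof. by move=> bb' i; rewrite /contract !bb'. Qed.

Lemma eq_eta_pairing k (pi : {set {set 'I_k}}) b b' : b =1 b' ->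
  eta_pairing eta pi b = eta_pairing eta pi b'.
Proof.
suff h n : forall k (pi : {set {set 'I_k}}) b b', (k < n)%N -> b =1 b' ->
    eta_pairing eta pi b = eta_pairing eta pi b' by exact: (h k.+1).
elim: n => [|n IH] {}k {}pi {}b {}b' //.
case: k pi => [|[|k]] pi kn bb' //=; case: pickP => // q _.
by apply: IH => //; [lia|apply: eq_contract].
Qed.

Lemma eq_psum k p b b' : b =1 b' -> psum k p b = psum k p b'.
Proof. by move=> bb'; apply: eq_bigr => pi _; apply: eq_eta_pairing. Qed.

Lemma opening0 k (pi : {set {set 'I_k}}) : opening 0 pi.
Proof. by case: k pi => [|[|k]] pi //=; apply/forallP => q; rewrite implybT. Qed.

Lemma psum1 p b : psum 1 p b = 0.
Proof. exact: big1. Qed.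

Lemma psum00 b : psum 0 0 b = b 0%N.
Proof.
rewrite /psum (eq_bigl (pred1 set0)) ?big_pred1_eq // => pi /=.
rewrite eqxx andbT; apply/NC2P/eqP => [[cd _ _ _]|->]; last first.
  by split=> [V|[]|V W|V W]; rewrite ?inE.
apply/setP => V; rewrite inE; apply/negP => /cd.
by have := max_card V => /[swap] ->; rewrite card_ord.
Qed.

Lemma psum_ge k p b : (0 < p)%N -> (k <= p)%N -> psum k p b = 0.
Proof.
case: k => [|[|k]] p0 kp.
  by rewrite /psum big_pred0 // => pi; rewrite /= (gtn_eqF p0) andbF.
  exact: psum1.
apply: big_pred0 => pi; apply/negP => /andP[/nc_has_adjacent[q qpi] /forallP/(_ q)].
by rewrite qpi /=; have := ltn_ord q; lia.
Qed.

Lemma psum_start k b : psum k.+1 0 b = psum k.+1 1 b.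
Proof.
case: k => [|k]; first by rewrite !psum1.
apply: eq_bigl => pi; rewrite opening0; congr (_ && _).
by apply/esym/forallP => q; rewrite implybT.
Qed.

(** After [p + 1] opening points, the next point either closes the last of
    them, which then forms an adjacent block, or opens a new pair. *)
Lemma psum_step k p b :
  psum k.+2 p.+1 b = psum k p (contract eta p b) + psum k.+2 p.+2 b.
Proof.
have [kp|pk] := ltnP k p; first by rewrite !psum_ge ?addr0 //; lia.
have pk1 : (p < k.+1)%N by [].
pose q := Ordinal pk1.
rewrite [LHS](bigID (fun pi : {set {set 'I_k.+2}} => adjacent q \in pi)) /=.
congr (_ + _); last first.
  apply: eq_bigl => pi; rewrite -andbA; congr (_ && _) => /=.
  apply/andP/forallP => [[/forallP h qpi] q'|h].
    apply/implyP => q'pi; have /implyP/(_ q'pi) := h q'.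
    rewrite ltnS leq_eqVlt => /orP[/eqP e|//].
    by move: qpi; rewrite (_ : q = q') ?q'pi //; apply: ord_inj; rewrite /= e.
  split.
    by apply/forallP => q'; apply/implyP => q'pi; have /implyP/(_ q'pi) := h q'; lia.
  by apply/negP => qpi; have /implyP/(_ qpi) := h q; rewrite /= ltnn.
rewrite (reindex_onto (insert_adjacent q) (remove_adjacent q)) /=; last first.
  by move=> pi /andP[/andP[h _] qpi]; apply: remove_adjacentK.
apply: eq_big => [pi|pi].
  rewrite insert_adjacentK eqxx andbT insert_nc /insert_adjacent in_setU1 eqxx andbT.
  have [h|//] := boolP (pi \in NC2 k); exact: (insert_opening q h).
move=> /andP[/andP[/andP[_ /forallP h] qin] /eqP rm].
rewrite (@pick_ord_min _ (fun q' => adjacent q' \in _) q) ?rm //.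
by move=> q' hq'; have /implyP/(_ hq') := h q'.
Qed.

Hypothesis psum_Ml : forall k x b,
  psum k 0 (fun i => if i is 0 then x * b 0%N else b i) = x * psum k 0 b.

(** The decomposition of a noncrossing pairing at the partner of its first
    point, of which [p] further opening points keep track inside. *)
Lemma psum_first k p b : psum k.+2 p.+1 b =
  \sum_(j < k.+1) b 0%N * eta (psum j p (fun i => b i.+1))
                  * psum (k - j) 0 (fun i => b (j + i).+2).
Proof.
elim/ltn_ind: k p b => k IHk p b.
have [d hd] : exists d, (k.+1 <= p + d)%N by exists k.+1; lia.
elim: d p b hd => [|d IHd] p b hd.
  rewrite psum_ge //; last lia.
  rewrite big1 // => j _; rewrite psum_ge; [|have := ltn_ord j; lia|have := ltn_ord j; lia].
  by rewrite linear0 mulr0 mul0r.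
rewrite psum_step IHd; last lia.
case: p hd => [|p] hd.
  rewrite big_ord_recl [in RHS]big_ord_recl /= [psum 0 1 _]psum_ge //.
  rewrite linear0 mulr0 mul0r add0r psum00 subn0; congr (_ + _); last first.
    by apply: eq_bigr => j _; rewrite -psum_start.
  rewrite -psum_Ml; apply: eq_psum => -[|i] //=.
case: k IHk hd IHd => [|[|k]] IHk hd IHd.
- rewrite psum_ge // add0r !big_ord1 /= [psum 0 p.+2 _]psum_ge //.
  by rewrite [psum 0 p.+1 _]psum_ge.
- rewrite psum1 add0r !big1 // => j _; have hj := ltn_ord j.
    by rewrite [psum j _ _]psum_ge ?linear0 ?mulr0 ?mul0r //; lia.
  by rewrite [psum j _ _]psum_ge ?linear0 ?mulr0 ?mul0r //; lia.
rewrite (IHk k) //.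
rewrite [X in _ + X = _]big_ord_recl [X in _ + (_ + X) = _]big_ord_recl /=.
rewrite [RHS]big_ord_recl [X in _ = _ + X]big_ord_recl /=.
rewrite !psum1 ![psum 0 _.+1 _]psum_ge // linear0 mulr0 !mul0r !add0r.
rewrite -big_split /=.
apply: eq_bigr => j _; rewrite /bump /= !add1n [psum j.+2 p.+1 _]psum_step.
rewrite linearD mulrDr mulrDl.
rewrite !subSS; congr (_ + _).
have [jp|pj] := ltnP j p.
  by rewrite ![psum j p _]psum_ge ?linear0 ?mulr0 ?mul0r //; lia.
rewrite (@eq_psum j p _ (contract eta p (fun i => b i.+1))); last first.
  by move=> i; rewrite /contract ltnS eqSS.
congr (_ * _); apply: eq_psum => i; rewrite /contract.
have -> : ((j + i).+2 < p.+1)%N = false by lia.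
by have -> : ((j + i).+2 == p.+1) = false by lia.
Qed.

End PairingSums.

(** * Moments of a semicircular element *)
Section SchwingerDyson.
Variables (R : realType) (A B : cstarType R) (P : cstar_prob_space A B).
Variables (eta : {linear B -> B}) (s : A) (hs : semicircular P eta s).
Local Notation j := (incl P).
Local Notation E := (expect P).
Implicit Types (r x : A) (b c g w : B) (u : nat -> A) (q t K e : R).

Lemma semicircular_sa : selfadjoint s. Proof. by case: hs. Qed.
Let ss := semicircular_sa.

Lemma psum_moment k (b : nat -> B) :
  psum eta k 0 b = E (j (b 0%N) * \prod_(i < k) (s * j (b i.+1))).
Proof.
case: hs => _ _ ->; apply: eq_bigl => pi; by rewrite opening0 andbT.
Qed.

Lemma psum_leftM k (x : B) (b : nat -> B) :
  psum eta k 0 (fun i => if i is 0 then x * b 0%N else b i) = x * psum eta k 0 b.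
Proof.
rewrite !psum_moment -E_Ml rmorphM mulrA; congr (E (_ * _)).
Qed.

Lemma psum_const k (x : B) g : psum eta k 0 (fun i => if i is 0 then x else g) =
  E (j x * (s * j g) ^+ k).
Proof. by rewrite psum_moment /= prodr_const card_ord. Qed.

(** The second moment; it makes [eta] not only positive, but 2-positive. *)
Lemma eta_E (x : B) : eta x = E (s * j x * s).
Proof.
pose b i : B := if i is 1 then x else 1.
have := psum_moment 2 b; rewrite psum_start (psum_first psum_leftM).
rewrite big_ord1 /= !psum00 /b /= mul1r mulr1 => ->.
by rewrite !big_ord_recl big_ord0 /= /bump /= rmorph1 mul1r !mulr1.
Qed.

Lemma eta_star (x : B) : eta (star x) = star (eta x).
Proof. by rewrite !eta_E -E_star !starM ss incl_star mulrA. Qed.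

Lemma cnorm_eta (x : B) : cnorm (eta x) <= cnorm s ^+ 2 * cnorm x.
Proof.
rewrite eta_E; apply: le_trans (cnorm_E _ _) _.
have -> : cnorm s ^+ 2 * cnorm x = cnorm s * cnorm x * cnorm s by ring.
by rewrite -(incl_norm P x); do 2 apply: cnormM_le => //.
Qed.

Lemma moment_rec g k : E ((s * j g) ^+ k.+2) =
  \sum_(i < k.+1) eta (E (j g * (s * j g) ^+ i)) * E (j g * (s * j g) ^+ (k - i)).
Proof.
rewrite -[_ ^+ _]mul1r -{1}(rmorph1 j) -psum_const psum_start.
rewrite (psum_first psum_leftM); apply: eq_bigr => i _; rewrite mul1r.
by congr (eta _ * _); rewrite -psum_const; apply: eq_psum => -[|?].
Qed.

Lemma moment1 g : E (s * j g) = 0.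
Proof.
by have := psum_const 1 1 g; rewrite psum1 rmorph1 mul1r expr1 => <-.
Qed.

(** The defect of [r] in the Schwinger-Dyson equation
    [E(s r) = eta(E r) E r] of resolvents. *)
Definition sd_defect r : B := E (s * r) - eta (E r) * E r.

(** The terms of degree [n] in the defect of [\sum_i u i], if [u i] has degree
    [i]. *)
Definition sd_coef u n : B :=
  E (s * u n) - \sum_(i < n.+1) eta (E (u i)) * E (u (n - i)%N).

Lemma cauchy_prod (a : nat -> B) N :
  \sum_(n < N) \sum_(i < n.+1) eta (a i) * a (n - i)%N =
  \sum_(i < N) eta (a i) * \sum_(l < N - i) a l.
Proof.
elim: N => [|N IH]; first by rewrite !big_ord0.
rewrite big_ord_recr /= IH [in RHS]big_ord_recr /= subSnn big_ord1.
rewrite [in X in _ + X]big_ord_recr /= subnn addrA -big_split /=; congr (_ + _).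
apply: eq_bigr => i _; rewrite -mulrDr; congr (_ * _).
by rewrite subSn ?big_ord_recr // ltnW.
Qed.

(** The Cauchy product of a geometrically convergent series with its image
    under [eta]; the tails of [\sum_i u i] enter only through their norms. *)
Lemma sd_expansion r u K q : 0 <= K -> 0 <= q ->
  (forall i, cnorm (u i) <= K * q ^+ i) ->
  (forall n, cnorm (r - \sum_(i < n) u i) <= K * q ^+ n) ->
  forall N, cnorm (sd_defect r - \sum_(n < N) sd_coef u n) <=
    (cnorm s * K + cnorm s ^+ 2 * K ^+ 2) * (N.+1%:R * q ^+ N).
Proof.
move=> K0 q0 hu hr N; pose a i := E (u i).
have qN0 : 0 <= q ^+ N by apply: exprn_ge0.
have s0 := cnorm_ge0 s.
have aE n : \sum_(i < n) a i = E (\sum_(i < n) u i) by rewrite linear_sum.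
have ha i : cnorm (a i) <= K * q ^+ i by apply: le_trans (cnorm_E _ _) _.
have hra n : cnorm (E r - \sum_(i < n) a i) <= K * q ^+ n.
  by rewrite aE -linearB; apply: le_trans (cnorm_E _ _) _.
have hE : cnorm (E r) <= K.
  by have := hra 0%N; rewrite big_ord0 subr0 expr0 mulr1.
have -> : sd_defect r - \sum_(n < N) sd_coef u n =
   E (s * (r - \sum_(n < N) u n)) - (eta (E r - \sum_(i < N) a i) * E r +
    \sum_(i < N) eta (a i) * (E r - \sum_(l < N - i) a l)).
  have -> : \sum_(n < N) sd_coef u n = E (s * \sum_(n < N) u n) -
      \sum_(i < N) eta (a i) * \sum_(l < N - i) a l.
    by rewrite -cauchy_prod mulr_sumr linear_sum -sumrB.
  have -> : \sum_(i < N) eta (a i) * (E r - \sum_(l < N - i) a l) =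
      eta (\sum_(i < N) a i) * E r - \sum_(i < N) eta (a i) * \sum_(l < N - i) a l.
    rewrite linear_sum mulr_suml -sumrB; apply: eq_bigr => i _; exact: mulrBr.
  rewrite /sd_defect mulrBr !linearB /=; set S1 := E (s * \sum_(n < N) _).
  by set S2 := eta (\sum_(n < N) _); set S3 := \sum_(n < N) _; ncring.
have n1 : cnorm (E (s * (r - \sum_(n < N) u n))) <= cnorm s * K * q ^+ N.
  by apply: le_trans (cnorm_E _ _) _; rewrite -mulrA; apply: cnormM_le.
have n2 : cnorm (eta (E r - \sum_(i < N) a i) * E r) <=
    cnorm s ^+ 2 * K ^+ 2 * q ^+ N.
  apply: le_trans (_ : cnorm s ^+ 2 * (K * q ^+ N) * K <= _); last by lra.
  apply: cnormM_le => //; apply: le_trans (cnorm_eta _) _.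
  by rewrite ler_wpM2l ?sqr_ge0.
have n3 : cnorm (\sum_(i < N) eta (a i) * (E r - \sum_(l < N - i) a l)) <=
    N%:R * (cnorm s ^+ 2 * K ^+ 2 * q ^+ N).
  apply: le_trans (cnorm_sum _ _ _) _.
  rewrite mulr_natl -[N in _ *+ N]card_ord -sumr_const; apply: ler_sum => i _.
  apply: le_trans (_ : cnorm s ^+ 2 * (K * q ^+ i) * (K * q ^+ (N - i)) <= _).
    apply: cnormM_le => //; apply: le_trans (cnorm_eta _) _.
    by rewrite ler_wpM2l ?sqr_ge0.
  have -> : q ^+ N = q ^+ i * q ^+ (N - i) by rewrite -exprD subnKC // ltnW.
  by set x := q ^+ i; set y := q ^+ (N - i); lra.
apply: le_trans (cnormB _ _) _; apply: le_trans (lerD n1 (cnormD_le n2 n3)) _.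
have N0 : 0 <= (N%:R : R) by [].
rewrite -natr1.
have : 0 <= N%:R * (cnorm s * K * q ^+ N) by rewrite !mulr_ge0.
lra.
Qed.

Lemma cnorm_eq0_lim (x : B) K q : 0 <= q < 1 ->
  (forall N, cnorm x <= K * (N.+1%:R * q ^+ N)) -> x = 0.
Proof.
move=> q01 h; apply: cnorm_small0 => e e0.
have [N /(_ N (leqnn _)) hN] := natr_exp_small K q01 e0.
exact: le_lt_trans (h N) hN.
Qed.
End SchwingerDyson.

(** * The Cauchy transform solves the quadratic equation *)
Section Resolvent.
Variables (R : realType) (A B : cstarType R) (P : cstar_prob_space A B).
Variables (eta : {linear B -> B}) (s : A) (hs : semicircular P eta s).
Local Notation j := (incl P).
Local Notation E := (expect P).
Local Notation resolvent := (resolvent P s).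
Local Notation sd_defect := (sd_defect P eta s).
Local Notation sd_coef := (sd_coef P eta s).
Implicit Types (r x : A) (b c g w : B) (q t K e : R).

Let ss : selfadjoint s := semicircular_sa hs.

(** For large [c] the resolvent is the sum of its Neumann series, whose terms
    have known moments; the coefficients of the Schwinger-Dyson defect
    telescope. *)
Lemma sd_res_large c e : 0 < e -> pos (imag c - sc (cnorm s + e)) ->
  sd_defect (resolvent c) = 0.
Proof.
move=> e0 cp; have s0 := cnorm_ge0 s.
have se : 0 < cnorm s + e by lra.
have [cu cn] := imag_ge_unit se cp; have [ju _] := res_unit P ss se cp.
set g := c^-1 in cn; pose q := cnorm s / (cnorm s + e).
have q0 : 0 <= q by rewrite divr_ge0 // ltW.
have q1 : q < 1 by rewrite ltr_pdivrMr // mul1r; lra.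
have sg : cnorm (s * j g) <= q by apply: cnormM_le; rewrite ?incl_norm.
have gs : cnorm (j g * s) <= q by rewrite /q mulrC; apply: cnormM_le; rewrite ?incl_norm.
set r := resolvent c; pose u n := j g * (s * j g) ^+ n.
have uE n : u n = (j g * s) ^+ n * j g.
  elim: n => [|n IH]; first by rewrite /u !expr0 mulr1 mul1r.
  by rewrite /u !exprSr mulrA -/(u n) IH !mulrA.
have rE : r - j g = j g * s * r.
  have gc : j g * j c = 1 by rewrite -rmorphM mulVr // rmorph1.
  have : j g * ((j c - s) * r) = j g by rewrite mulrV // mulr1.
  by rewrite mulrBl mulrBr mulrA gc mul1r => h; rewrite -[X in r - X]h; ncring.
have tail n : r - \sum_(i < n) u i = (j g * s) ^+ n * r.
  elim: n => [|n IH]; first by rewrite big_ord0 subr0 mul1r.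
  by rewrite big_ord_recr /= opprD addrA IH uE -mulrBr rE mulrA -exprSr.
pose K := cnorm (j g) + cnorm r.
have g0 := cnorm_ge0 (j g); have r0 := cnorm_ge0 r.
have K0 : 0 <= K by rewrite addr_ge0.
have hu i : cnorm (u i) <= K * q ^+ i.
  apply: le_trans (_ : cnorm (j g) * q ^+ i <= _).
    apply: cnormM_le => //; apply: le_trans (cnormX _ _) _.
    by rewrite lerXn2r // nnegrE cnorm_ge0.
  by rewrite ler_wpM2r ?exprn_ge0 // /K; lra.
have hr n : cnorm (r - \sum_(i < n) u i) <= K * q ^+ n.
  rewrite tail [K * _]mulrC; apply: cnormM_le; last by rewrite /K; lra.
  by apply: le_trans (cnormX _ _) _; rewrite lerXn2r // nnegrE cnorm_ge0.
have coef N : \sum_(n < N) sd_coef u n = - E ((s * j g) ^+ N.+1).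
  elim: N => [|N IH]; first by rewrite big_ord0 expr1 (moment1 hs) oppr0.
  rewrite big_ord_recr /= IH /sd_coef /u mulrA -exprS -(moment_rec hs).
  by rewrite addrA addNr sub0r.
set C := cnorm s * K + cnorm s ^+ 2 * K ^+ 2.
apply: (@cnorm_eq0_lim _ _ _ (C + 1) q); first by rewrite q0.
move=> N; have := sd_expansion hs K0 q0 hu hr N; rewrite coef opprK -/C => h.
have h2 : cnorm (E ((s * j g) ^+ N.+1)) <= q ^+ N.
  apply: le_trans (cnorm_E _ _) _; apply: le_trans (cnormX _ _) _.
  apply: le_trans (_ : q ^+ N.+1 <= _).
    by rewrite lerXn2r // nnegrE cnorm_ge0.
  by rewrite exprS ler_piMl ?exprn_ge0 // ltW.
have h3 : q ^+ N <= N.+1%:R * q ^+ N.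
  by rewrite ler_peMl ?exprn_ge0 // ler1n.
rewrite -[sd_defect r](addrK (E ((s * j g) ^+ N.+1))).
by apply: le_trans (cnormB _ _) _; lra.
Qed.

(** The defect of [b - i t] along the segment from [c = b + i t0] to [b] is the
    sum of a power series in [t], since [t0] is less than the distance of [c]
    to the boundary of the half-plane.  It vanishes near [c], hence so do all
    coefficients. *)
Lemma sd_res b e : 0 < e -> pos (imag b - sc e) -> sd_defect (resolvent b) = 0.
Proof.
move=> e0 bp; have s0 := cnorm_ge0 s.
(* [Im (b + i (t0 - t))] exceeds [|s|] for [t <= 1], so that [sd_res_large]
   applies *)
pose t0 : R := cnorm s + 1; have t00 : 0 < t0 by rewrite /t0; lra.
pose c t := b + ii B * sc (t0 - t).
have cp t : pos (imag (c t) - sc (e + (t0 - t))).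
  have -> : imag (c t) - sc (e + (t0 - t)) = imag b - sc e; last by [].
  rewrite /c -[X in imag X]opprK imagN opprD imagB imagN imag_iisc (scD _ e).
  ncring.
have cu t : t <= t0 ->
    j (c t) - s \is a GRing.unit /\ cnorm (resolvent (c t)) <= (e + (t0 - t))^-1.
  by move=> h; apply: res_unit => //; lra.
pose r := resolvent (c 0); pose m := ii A * r.
have [r_u rn] := cu 0 (ltW t00); rewrite subr0 -/r in rn.
pose rho := (e + t0)^-1; have et0 : 0 < e + t0 by lra.
have rho0 : 0 < rho by rewrite invr_gt0.
have mn : cnorm m <= rho by rewrite /m cnorm_ii.
pose u t n := sc (t ^+ n) * (m ^+ n * r).
have rt t : t <= t0 -> resolvent (c t) - r = sc t * m * resolvent (c t).
  move=> ht; have [ru _] := cu t ht.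
  have h1 : r * ((j (c t) - s) * resolvent (c t)) = r by rewrite mulrV // mulr1.
  have h2 : r * (j (c 0) - s) * resolvent (c t) = resolvent (c t) by rewrite mulVr // mul1r.
  rewrite -{1}h2 -{2}h1 mulrA -mulrBl -mulrBr; congr (_ * _).
  have -> : j (c 0) - s - (j (c t) - s) = j (c 0 - c t) by rewrite rmorphB; ncring.
  have -> : c 0 - c t = ii B * sc t.
    by rewrite /c subr0 scB mulrBr; ncring.
  by rewrite rmorphM /= incl_ii incl_sc /m [LHS]mulrA scC iiC.
have tail t n : t <= t0 ->
    resolvent (c t) - \sum_(i < n) u t i = sc (t ^+ n) * (m ^+ n * resolvent (c t)).
  move=> ht; elim: n => [|n IH]; first by rewrite big_ord0 subr0 !expr0 sc1 !mul1r.
  rewrite big_ord_recr /= opprD addrA IH /u -!mulrBr rt //.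
  by rewrite !mulrA scC !exprSr scM !mulrA -(mulrA (sc t)) scC !mulrA scC -scM mulrC scM.
pose K := rho + e^-1.
have K0 : 0 <= K by rewrite addr_ge0 // ?invr_ge0 ltW.
have hu t i : 0 <= t -> cnorm (u t i) <= K * (t * rho) ^+ i.
  move=> ht; rewrite cnorm_scM ger0_norm ?exprn_ge0 //.
  apply: le_trans (_ : t ^+ i * (rho ^+ i * K) <= _); last by rewrite exprMn; lra.
  rewrite ler_wpM2l ?exprn_ge0 //; apply: cnormM_le.
    apply: le_trans (cnormX _ _) _.
    by rewrite lerXn2r // ?nnegrE ?cnorm_ge0 // ltW.
  by apply: le_trans rn _; rewrite /K lerDl invr_ge0 ltW.
have hr t n : 0 <= t -> t <= t0 ->
    cnorm (resolvent (c t) - \sum_(i < n) u t i) <= K * (t * rho) ^+ n.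
  move=> ht ht0; rewrite tail // cnorm_scM ger0_norm ?exprn_ge0 //.
  apply: le_trans (_ : t ^+ n * (rho ^+ n * K) <= _); last by rewrite exprMn; lra.
  rewrite ler_wpM2l ?exprn_ge0 //; apply: cnormM_le.
    apply: le_trans (cnormX _ _) _.
    by rewrite lerXn2r // ?nnegrE ?cnorm_ge0 // ltW.
  have [_ h] := cu t ht0; apply: le_trans h _.
  apply: le_trans (_ : e^-1 <= _); last by rewrite /K lerDr ltW.
  by rewrite lef_pV2 ?posrE //; lra.
pose C := cnorm s * K + cnorm s ^+ 2 * K ^+ 2.
have C0 : 0 <= C by rewrite addr_ge0 // mulr_ge0 // sqr_ge0.
have main t N : 0 <= t -> t <= t0 ->
    cnorm (sd_defect (resolvent (c t)) - \sum_(n < N) sd_coef (u t) n) <=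
      C * (N.+1%:R * (t * rho) ^+ N).
  move=> ht ht0; apply: sd_expansion => //; first by rewrite mulr_ge0 // ltW.
  - by move=> i; apply: hu.
  - by move=> n; apply: hr.
have near t : t <= 1 -> sd_defect (resolvent (c t)) = 0.
  move=> ht; apply: (@sd_res_large _ e) => //.
  have -> : imag (c t) - sc (cnorm s + e) = imag (c t) - sc (e + (t0 - t)) + sc (1 - t).
    have -> : cnorm s + e = e + (t0 - t) - (1 - t) by rewrite /t0; ring.
    by rewrite (scB _ (e + _)); ncring.
  by apply: posD => //; apply: pos_sc; lra.
(* all powers of [t] in the expansion can be taken out *)
have coefE t n : sd_coef (u t) n = sc (t ^+ n) * sd_coef (u 1) n.
  have uE i : u t i = sc (t ^+ i) * u 1 i by rewrite /u expr1n sc1 mul1r.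
  have EM (x : R) (y : A) : E (sc x * y) = sc x * E y by rewrite -(incl_sc P) E_Ml.
  rewrite /sd_coef mulrBr; congr (_ - _).
    by rewrite uE mulrA scC -mulrA EM.
  rewrite mulr_sumr; apply: eq_bigr => i _; rewrite !(uE i) (uE (n - i)%N) !EM.
  rewrite -scE linearZ /= scE mulrA -(mulrA (sc _)) scC !mulrA -scM -exprD.
  by rewrite addnC subnK // -ltnS.
(* If the coefficients of degree less than [n] vanish, then [main] with
   [N = n + 1] bounds the next one by a multiple of [t], for all small [t]. *)
have D0 n : sd_coef (u 1) n = 0.
  elim/ltn_ind: n => n IH; pose L := C * (n.+2%:R * rho ^+ n.+1).
  have L0 : 0 <= L by rewrite mulr_ge0 // mulr_ge0 // exprn_ge0 // ltW.
  apply: cnorm_small0 => e' e'0; pose t := e' / (L + e' + 1).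
  have Le : 0 < L + e' + 1 by lra.
  have tt : 0 < t by rewrite divr_gt0.
  have t1 : t <= 1 by rewrite ler_pdivrMr // mul1r; lra.
  have := main t n.+1 (ltW tt) (le_trans t1 _); rewrite near // sub0r cnormN.
  rewrite big_ord_recr /= big1 ?add0r; last by move=> i _; rewrite coefE IH // mulr0.
  rewrite coefE cnorm_scM ger0_norm ?exprn_ge0 ?(ltW tt) //.
  rewrite [(t * rho) ^+ _]exprMn (exprSr t) => /(_ ltac:(rewrite /t0; lra)) h.
  have tn : 0 < t ^+ n by rewrite exprn_gt0.
  have {}h : cnorm (sd_coef (u 1) n) <= L * t.
    rewrite -(ler_pM2l tn); apply: le_trans h _; rewrite /L; lra.
  apply: le_lt_trans h _; rewrite /t mulrA ltr_pdivrMr //; nra.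
have cb : c t0 = b by rewrite /c subrr sc0 mulr0 addr0.
rewrite -cb; have q01 : 0 <= t0 * rho < 1.
  rewrite mulr_ge0 ?ltW //= /rho ltr_pdivrMr // mul1r; lra.
apply: (@cnorm_eq0_lim _ _ _ C _ q01) => N.
have := main t0 N (ltW t00) (lexx _); rewrite big1 ?subr0 // => n _.
by rewrite coefE D0 mulr0.
Qed.

Local Notation G := (cauchy_transform P s).

Lemma cauchy_transform_eq b e : 0 < e -> pos (imag b - sc e) ->
  b * G b = 1 + eta (G b) * G b.
Proof.
move=> e0 bp; have [bu _] := res_unit P ss e0 bp.
have := sd_res e0 bp => /eqP; rewrite /sd_defect subr_eq0 => /eqP h.
rewrite /cauchy_transform -E_Ml -/(resolvent b) -[X in 1 + X]h.
have -> : j b * resolvent b = 1 + s * resolvent b.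
  by rewrite -(mulrV bu) -mulrDl subrK.
by rewrite linearD -(rmorph1 j) expect_incl.
Qed.

(** [- Im R = R (Im b) R^*] for the resolvent [R], and [E] preserves lower
    bounds. *)
Lemma cauchy_transform_lower b e : 0 < e -> pos (imag b - sc e) ->
  exists2 d, 0 < d & pos (- imag (G b) - sc d).
Proof.
move=> e0 bp; have [bu _] := res_unit P ss e0 bp.
have cp : pos (imag (j b - s) - sc e).
  rewrite imagB (imag_sa ss) subr0 incl_imag -(incl_sc P) -rmorphB.
  exact: incl_pos.
have [|d d0 dp] := conj_lower _ e0 cp (y := resolvent b); first by rewrite unitrV.
exists d => //; rewrite E_imag imag_invr // -/(resolvent b).
by rewrite -(E_sc P d) linearN opprK -linearB; apply: E_pos.
Qed.

End Resolvent.

(** * Uniqueness of the solution in the lower half-plane *)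
Section SchurComplement.
Variables (R : realType) (A : cstarType R).
Implicit Types (a c v w y : A) (M : R).

(** The quadratic form of the matrix with rows [M v, y] and [y^*, M w]. *)
Definition hform M v y w a c : A := sc M * (star a * v * a) +
  (star a * y * c + star c * star y * a) + sc M * (star c * w * c).

(** Completing the square reduces positivity of [hform] to that of the Schur
    complement. *)
Lemma hform_pos M v y w : 0 < M -> pos v -> v \is a GRing.unit ->
  pos (sc (M ^+ 2) * w - star y * v^-1 * y) ->
  forall a c, pos (hform M v y w a c).
Proof.
move=> M0 vp vu h a c; have [vs _] := vp; apply: (@posZV _ _ M) => //.
set z := sc M * (v * a) + y * c.
have zs : star z = sc M * (star a * v) + star c * star y.
  by rewrite starD !starM star_sc vs scC.
have -> : sc M * hform M v y w a c = star z * v^-1 * z +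
    star c * (sc (M ^+ 2) * w - star y * v^-1 * y) * c.
  have -> : star z * v^-1 * z = sc M * sc M * (star a * v * a) +
      sc M * (star a * y * c + star c * star y * a) +
      star c * (star y * v^-1 * y) * c.
    have e1 : star z * v^-1 = sc M * star a + star c * star y * v^-1.
      by rewrite zs mulrDl -!mulrA mulrV // mulr1.
    rewrite e1 /z mulrDl !mulrDr.
    have -> : star c * star y * v^-1 * (sc M * (v * a)) = sc M * (star c * star y * a).
      rewrite (mulrA _ (sc M)) scC -!mulrA; congr (_ * (_ * (_ * _))).
      by rewrite mulrA mulVr // mul1r.
    by rewrite (mulrA (sc M * star a)) -(mulrA (sc M) (star a)) scC; ncring.
  rewrite [star c * (_ - _)]mulrBr [(_ - _) * c]mulrBl (mulrA (star c) (sc _)).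
  by rewrite (scC _ (star c)) expr2 scM /hform; ncring.
apply: posD; last exact: pos_conj.
by apply: pos_conj; apply: posV.
Qed.

(** Evaluate [hform] at [c = 1] and [a = - M^-1 v^-1 y]. *)
Lemma hform_schur M v y w : 0 < M -> pos v -> v \is a GRing.unit ->
  (forall a c, pos (hform M v y w a c)) ->
  pos (sc (M ^+ 2) * w - star y * v^-1 * y).
Proof.
move=> M0 vp vu h; have [vs _] := vp; have MN0 := lt0r_neq0 M0.
have := posZ (ltW M0) (h (- (sc M^-1 * (v^-1 * y))) 1); congr pos.
set a := sc M^-1 * (v^-1 * y).
have saE : star a = sc M^-1 * (star y * v^-1).
  by rewrite !starM star_sc starV // vs scC.
have e1 : star a * v = sc M^-1 * star y by rewrite saE -!mulrA mulVr // mulr1.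
have e2 : star a * v * a = sc M^-1 * (sc M^-1 * (star y * v^-1 * y)).
  by rewrite e1 /a -mulrA (mulrA (star y)) scC !mulrA.
have e3 : star a * y = sc M^-1 * (star y * v^-1 * y) by rewrite saE -!mulrA.
have e4 : star y * a = sc M^-1 * (star y * v^-1 * y).
  by rewrite /a mulrA scC -!mulrA.
rewrite /hform starN !mulNr !mulrN opprK star1 !mulr1 !mul1r e2 e3 e4.
set T := star y * v^-1 * y.
rewrite !mulrDr scK // !mulrN scK // expr2 scM; ncring.
Qed.

End SchurComplement.

Section Uniqueness.
Variables (R : realType) (A B : cstarType R) (P : cstar_prob_space A B).
Variables (eta : {linear B -> B}) (s : A) (hs : semicircular P eta s).
Local Notation j := (incl P).
Local Notation E := (expect P).
Implicit Types (b v w x y : B) (e d q t M : R).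

Let ss : selfadjoint s := semicircular_sa hs.

Lemma eta_imag x : imag (eta x) = eta (imag x).
Proof. by rewrite /imag -(eta_star hs) -linearB -linearZ. Qed.

Lemma lower_unit w d : 0 < d -> pos (- imag w - sc d) -> w \is a GRing.unit.
Proof. by move=> d0; rewrite -imagN -unitrN => /(imag_ge_unit d0)[]. Qed.

Lemma pos_scale_below p v d : 0 < d -> pos (p - sc d) -> pos v ->
  exists2 t, 0 < t & forall t', 0 <= t' -> t' <= t -> pos (p - sc t' * v).
Proof.
move=> d0 pd [vs _]; have v0 := cnorm_ge0 v; have v1 : 0 < cnorm v + 1 by lra.
exists (d / (cnorm v + 1)); first by rewrite divr_gt0.
move=> t' t0; rewrite ler_pdivlMr // => tt.
have -> : p - sc t' * v = (p - sc d) + (sc d - sc t' * v) by ncring.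
apply: posD => //; apply: pos_scB; first exact: saZ.
by rewrite cnorm_scM ger0_norm //; lra.
Qed.

Lemma E_sandwich v y w : E (j y * (s * j v * s) * j w) = y * eta v * w.
Proof. by rewrite expect_bimod -(eta_E hs). Qed.

(** The map [x |-> w1 eta(x) w2] contracts the quantity
    [inf {M | [M v1, x; x^*, M v2] >= 0}], because [eta(x) = E(s x s)] is
    2-positive. *)
Lemma schur_contract w1 w2 v1 v2 x M q : 0 < M -> 0 < q ->
  pos v1 -> v1 \is a GRing.unit -> w1 * eta x * w2 = x ->
  pos (sc q * v1 - w1 * eta v1 * star w1) ->
  pos (sc q * v2 - star w2 * eta v2 * w2) ->
  pos (sc (M ^+ 2) * v2 - star x * v1^-1 * x) ->
  pos (sc ((q * M) ^+ 2) * v2 - star x * v1^-1 * x).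
Proof.
move=> M0 q0 v1p v1u hx h1 h2 hM.
apply: hform_schur => //; first exact: mulr_gt0.
move=> a c.
have jv1u : j v1 \is a GRing.unit by apply: rmorph_unit.
have hA : pos (sc (M ^+ 2) * j v2 - star (j x) * (j v1)^-1 * j x).
  rewrite -incl_star -rmorphV // -(incl_sc P) -!rmorphM -rmorphB.
  exact: incl_pos.
have hE := E_pos P (hform_pos M0 (incl_pos P v1p) jv1u hA
  (s * j (star w1 * a)) (s * j (w2 * c))).
have {}hE : pos (hform M (w1 * eta v1 * star w1) x (star w2 * eta v2 * w2) a c).
  move: hE; congr pos; rewrite /hform !starM ss -!incl_star !starM !starK.
  have EM t (z : A) : E (sc t * z) = sc t * E z by rewrite -(incl_sc P) E_Ml.
  have sand (y y' v : B) : E (j y * s * j v * (s * j y')) = y * eta v * y'.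
    by rewrite -E_sandwich !mulrA.
  rewrite !linearD /= !EM !sand.
  congr (_ * _ + (_ + _) + _ * _); rewrite ?mulrA //.
    by rewrite -{2}hx !mulrA.
  by rewrite -{2}hx !starM (eta_star hs) !mulrA.
have -> : hform (q * M) v1 x v2 a c =
    sc M * (star a * (sc q * v1 - w1 * eta v1 * star w1) * a) +
    sc M * (star c * (sc q * v2 - star w2 * eta v2 * w2) * c) +
    hform M (w1 * eta v1 * star w1) x (star w2 * eta v2 * w2) a c.
  have sq (y v : B) : sc (q * M) * (star y * v * y) = sc M * (star y * (sc q * v) * y).
    by rewrite (mulrA (star y)) scC mulrC scM -!mulrA.
  rewrite /hform !sq; ncring.
by apply: posD => //; apply: posD; apply: posZ; rewrite ?ltW //; apply: pos_conj.
Qed.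

(** For [vi = - Im wi] the equation gives [v1 = w1 (Im b + eta(v1)) w1^*], so
    that [w1 eta(v1) w1^* <= q v1] for some [q < 1], and similarly for [v2].  The
    difference [x = w1 - w2] satisfies [x = w1 eta(x) w2].  By [schur_contract]
    the bound [x^* v1^-1 x <= M^2 v2] remains true for all [q^n M]. *)
Lemma semicircular_eq_unique b w1 w2 e d1 d2 : 0 < e -> pos (imag b - sc e) ->
  0 < d1 -> pos (- imag w1 - sc d1) -> 0 < d2 -> pos (- imag w2 - sc d2) ->
  w1^-1 = b - eta w1 -> w2^-1 = b - eta w2 -> w1 = w2.
Proof.
move=> e0 bp d10 p1 d20 p2 q1 q2.
have w1u := lower_unit d10 p1; have w2u := lower_unit d20 p2.
set v1 := - imag w1 in p1 *; set v2 := - imag w2 in p2 *.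
have v1p : pos v1 by rewrite -(subrK (sc d1) v1); apply: posD => //; apply/pos_sc/ltW.
have v2p : pos v2 by rewrite -(subrK (sc d2) v2); apply: posD => //; apply/pos_sc/ltW.
have v1u : v1 \is a GRing.unit by rewrite -(subrK (sc d1) v1); apply: pos_unit.
have iE w : w^-1 = b - eta w -> imag w^-1 = imag b + eta (- imag w).
  by move=> ->; rewrite imagB eta_imag linearN.
have v1E : v1 = w1 * (imag b + eta v1) * star w1.
  rewrite -iE // /v1 -{1}(invrK w1) imag_invr ?unitrV // opprK !invrK.
  by [].
have v2E : v2 = star w2 * (imag b + eta v2) * w2.
  rewrite -iE // /v2 -{1}(invrK w2) imag_invl ?unitrV // opprK !invrK.
  by [].
have [c1 c10 hc1] := conj_lower w1u e0 bp.
have [|c2 c20] := conj_lower _ e0 bp (y := star w2); first by rewrite star_unit.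
rewrite starK => hc2.
have [t1 t10 ht1] := pos_scale_below c10 hc1 v1p.
have [t2 t20 ht2] := pos_scale_below c20 hc2 v2p.
pose t := Num.min (Num.min t1 t2) 2^-1.
have t0 : 0 < t by rewrite !lt_min t10 t20 invr_gt0 /=.
have tt1 : t <= t1 by rewrite !ge_min lexx.
have tt2 : t <= t2 by rewrite !ge_min lexx orbT.
have t12 : t <= 2^-1 by rewrite !ge_min lexx orbT.
pose q := 1 - t; have q0 : 0 < q by rewrite /q; lra.
have q1' : q < 1 by rewrite /q; lra.
have h1 : pos (sc q * v1 - w1 * eta v1 * star w1).
  have -> : sc q * v1 - w1 * eta v1 * star w1 = w1 * imag b * star w1 - sc t * v1.
    by rewrite /q scB sc1 mulrBl mul1r {1}v1E; ncring.
  exact: ht1 (ltW t0) tt1.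
have h2 : pos (sc q * v2 - star w2 * eta v2 * w2).
  have -> : sc q * v2 - star w2 * eta v2 * w2 = star w2 * imag b * w2 - sc t * v2.
    by rewrite /q scB sc1 mulrBl mul1r {1}v2E; ncring.
  exact: ht2 (ltW t0) tt2.
have [x xE] : exists x, x = w1 - w2 by exists (w1 - w2).
have hx : w1 * eta x * w2 = x.
  have -> : eta x = w2^-1 - w1^-1 by rewrite q1 q2 xE linearB; ncring.
  by rewrite xE mulrBr mulrBl mulrV // mul1r -mulrA mulVr // mulr1.
pose T := star x * v1^-1 * x.
have Tp : pos T by apply: pos_conj; apply: posV.
have [Ts _] := Tp; have T0 := cnorm_ge0 T.
pose M := cnorm T / d2 + 1.
have Td : 0 <= cnorm T / d2 by rewrite divr_ge0 // ltW.
have M0 : 0 < M by rewrite /M; lra.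
have hM : pos (sc (M ^+ 2) * v2 - T).
  have -> : sc (M ^+ 2) * v2 - T = sc (M ^+ 2) * (v2 - sc d2) + (sc (M ^+ 2 * d2) - T).
    by rewrite scM mulrBr; ncring.
  apply: posD; first by apply: posZ => //; apply: sqr_ge0.
  apply: pos_scB => //; rewrite -ler_pdivrMr //.
  by apply: le_trans (_ : M <= _); rewrite /M ?expr2; nra.
have hn n : 0 < q ^+ n * M /\ pos (sc ((q ^+ n * M) ^+ 2) * v2 - T).
  elim: n => [|n [IH1 IH2]]; first by rewrite expr0 mul1r.
  rewrite exprS -mulrA; split; first exact: mulr_gt0.
  exact: schur_contract hx h1 h2 IH2.
have TE : T = 0.
  apply: (@cnorm_eq0_lim _ _ _ (M ^+ 2 * cnorm v2) q); first by rewrite q1' ltW.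
  move=> n; have [_ h] := hn n; apply: le_trans (cnorm_mono Tp h) _.
  rewrite cnorm_scM ger0_norm ?sqr_ge0 // exprMn.
  have qn0 : 0 <= q ^+ n by rewrite exprn_ge0 // ltW.
  have qn1 : q ^+ n <= 1 by rewrite exprn_ile1 // ltW.
  have n1 : (1 : R) <= n.+1%:R by rewrite ler1n.
  have Mv : 0 <= M ^+ 2 * cnorm v2 by rewrite mulr_ge0 ?sqr_ge0 ?cnorm_ge0.
  apply: le_trans (_ : M ^+ 2 * cnorm v2 * q ^+ n <= _).
    rewrite -[leLHS]mulrA [leLHS]mulrC ler_wpM2l //.
    by rewrite expr2 ler_piMl.
  by rewrite ler_wpM2l // ler_peMl.
have v1V := pos_ge_invnorm (posV v1p v1u); rewrite unitrV invrK in v1V.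
have {}v1V := pos_conj x (v1V v1u).
have v1n : 0 < (cnorm v1)^-1 by rewrite invr_gt0 -(invrK v1) cnormV_gt0 ?unitrV.
apply/eqP; rewrite -subr_eq0 -xE; apply/eqP/cnorm_eq0/eqP.
rewrite -sqrf_eq0 eq_le sqr_ge0 andbT -cnorm_star.
rewrite -(ler_pM2l v1n) mulr0 -[X in X * _](gtr0_norm v1n) -cnorm_scM.
rewrite -[leRHS](cnorm0 B); apply: cnorm_mono.
  by apply: posZ; [apply: ltW|apply: pos_star].
by move: v1V; rewrite mulrBr mulrBl -/T TE scC -mulrA.
Qed.

End Uniqueness.

(** * Cauchy-Schwarz for states *)
Section States.
Variables (R : realType) (A B : cstarType R) (P : cstar_prob_space A B).
Variables (phi : {linear B -> R[i]^o}) (hphi : is_state phi).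
Local Notation E := (expect P).
Implicit Types (x y : A) (b : B) (t : R).

Lemma state_Z (c : R[i]) b : phi (c *: b) = c * phi b.
Proof. exact: linearZ. Qed.
Lemma state_sc t b : phi (sc t * b) = t%:C * phi b.
Proof. by rewrite -scE linearZ. Qed.

Lemma state_pos b : pos b -> 0 <= complex.Re (phi b) /\ complex.Im (phi b) = 0.
Proof.
move=> bp; case: hphi => hp h1.
have h e : 0 < e -> 0 <= complex.Re (phi b) + e /\ complex.Im (phi b) = 0.
  move=> e0; have [h [hs hE _]] := pos_sqrt bp e0.
  have := hp (b + sc e); rewrite -hE => /(_ (ex_intro _ h _)).
  rewrite {1}hs => /(_ erefl); rewrite hE linearD /= -[sc e]mulr1 state_sc h1 mulr1.
  by case: (phi b) => u v; rewrite lecE /= addr0 => /andP[/eqP -> ->].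
split; last by have [] := h 1 ltr01.
by apply/ler_addgt0Pr => e /h[]; rewrite addrC.
Qed.

Lemma state_sa b : selfadjoint b -> complex.Im (phi b) = 0.
Proof.
move=> bs; have [_] := state_pos (pos_scD bs (lexx _)).
case: hphi => _ h1; rewrite linearD /= -[sc _]mulr1 state_sc h1 mulr1.
by case: (phi b) => u v /=; rewrite add0r.
Qed.

Lemma state_decomp b : exists t,
  [/\ phi b = t%:C + 'i * phi (imag b), phi (star b) = t%:C - 'i * phi (imag b) &
    complex.Im (phi (imag b)) = 0].
Proof.
have [u us bE] := sa_decomp b; have H := state_sa us.
move: (imag b) (sa_imag b) bE => v vs bE; exists (complex.Re (phi u)).
have -> : (complex.Re (phi u))%:C = phi u by move: H; case: (phi u) => a c /= ->.
rewrite bE starD starZ us vs conj_i !linearD !state_Z mulNr.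
by split=> //; apply: state_sa.
Qed.

Lemma state_imag b : complex.Re (phi (imag b)) = complex.Im (phi b).
Proof.
have [t [-> _]] := state_decomp b.
by case: (phi (imag b)) => a c /= ->; ring.
Qed.

Lemma state_star b : complex.Re (phi (star b)) = complex.Re (phi b).
Proof.
have [t [-> ->]] := state_decomp b.
by case: (phi (imag b)) => a c /= ->; ring.
Qed.

(** After multiplication of [y] by a scalar, [phi (E (x^* y))] is real and
    nonnegative; the discriminant argument then only involves the real part of
    [phi o E], which is invariant under the involution. *)
Lemma state_cauchy_schwarz x y :
  normc (phi (E (star x * y))) ^+ 2 <=
    complex.Re (phi (E (star x * x))) * cnorm y ^+ 2.
Proof.
pose f z : R := complex.Re (phi (E z)).
have fD z z' : f (z + z') = f z + f z' by rewrite /f !linearD.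
have fsc t z : f (sc t * z) = t * f z.
  rewrite /f -(incl_sc P) E_Ml state_sc.
  by case: (phi _) => a c /=; rewrite mul0r subr0.
have f_ge0 z : pos z -> 0 <= f z by move=> /(E_pos P)/state_pos[].
have fstar z : f (star z) = f z by rewrite /f E_star state_star.
have f_sc t : f (sc t) = t.
  by case: hphi => _ h1; rewrite -[sc t]mulr1 fsc /f -(sc1 A) E_sc sc1 h1 mulr1.
have fle z : f (star z * z) <= cnorm z ^+ 2.
  have := f_ge0 _ (pos_scB (sa_starM z) (lexx _)).
  by rewrite cnorm_star -mulN1r -sc1 -scN fD fsc f_sc; lra.
(* the scalar [conj a] turns the value [a] into [|a|^2] *)
set a := phi (E (star x * y)); pose y' := a^*%C *: y.
have fxy' : f (star x * y') = normc a ^+ 2.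
  rewrite /f /y' -scalerAr linearZ state_Z -/a.
  case: (a) => u v /=; rewrite sqr_sqrtr ?addr_ge0 ?sqr_ge0 //; ring.
have ny' : cnorm y' = normc a * cnorm y.
  rewrite /y' cnormZ; congr (_ * _); case: (a) => u v /=; by rewrite sqrrN.
have na : 0 <= normc a by case: (a) => u v; apply: sqrtr_ge0.
have real_cs (l : R) : 0 <= f (star x * x) - 2 * l * f (star x * y')
    + l ^+ 2 * cnorm y' ^+ 2.
  have := f_ge0 _ (pos_star (x - sc l * y')).
  have -> : star (x - sc l * y') * (x - sc l * y') = star x * x
      + sc (- l) * (star x * y' + star (star x * y')) + sc (l ^+ 2) * (star y' * y').
    rewrite starB !starM star_sc starK scC expr2 scM scN.
    rewrite mulrBl !mulrBr (mulrA (star x)) scC -!mulrA (mulrA (star y')) scC.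
    by rewrite -!mulrA; ncring.
  rewrite !fD !fsc fD fstar; have := fle y'; have := sqr_ge0 l; nra.
have [a0|a0] := eqVneq (normc a) 0.
  rewrite a0 expr0n /=; apply: mulr_ge0; last exact: sqr_ge0.
  by apply/f_ge0/pos_star.
have {}na : 0 < normc a by rewrite lt_def a0.
have [y0|y0] := eqVneq (cnorm y) 0.
  by move: a0; rewrite /a (cnorm_eq0 _ y0) mulr0 !linear0 normc0 eqxx.
have ny : 0 < cnorm y by rewrite lt_def y0 cnorm_ge0.
have ny2 : 0 < cnorm y ^+ 2 by rewrite exprn_gt0.
have := real_cs (cnorm y ^+ 2)^-1; rewrite fxy' ny' exprMn -/(f (star x * x)).
set F := f (star x * x); set n2 := normc a ^+ 2; set d := cnorm y ^+ 2.
have dN : d != 0 by apply: lt0r_neq0.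
have -> : F - 2 * d^-1 * n2 + d^-1 ^+ 2 * (n2 * d) = (F * d - n2) / d by field.
by rewrite pmulr_lge0 ?invr_gt0 // subr_ge0.
Qed.

End States.

(** * The estimate *)

Unset Implicit Arguments.
Set Strict Implicit.
Set Printing Implicit Defensive.
Local Close Scope complex_scope.

Theorem propositionB6 (R : realType) (A B : cstarType R)
    (P : cstar_prob_space A B) (eta : {linear B -> B}) (s : A)
    (hs : semicircular P eta s)
    (b : B) (hb : upper_half b)
    (wt : B) (hwt : lower_half wt)
    (sigma : R) (sigma_gt0 : 0 < sigma) (sigma_lt1 : sigma < 1)
    (hDelta : cnorm (Delta eta b wt) <= sigma * (cnorm (imag b)^-1)^-1) :
  let w := cauchy_transform P s b in
  (cnorm (wt - w) <=
     1 / (1 - sigma) * cnorm (imag b)^-1 ^+ 2 * cnorm (Delta eta b wt) /\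
   1 / (1 - sigma) * cnorm (imag b)^-1 ^+ 2 * cnorm (Delta eta b wt) <=
     sigma / (1 - sigma) * cnorm (imag b)^-1) /\
  (forall phi : {linear B -> R[i]^o}, is_state phi ->
     normc (phi wt - phi w) <=
       1 / (1 - sigma) * Num.sqrt (Theta P s phi b)
         * cnorm (imag b)^-1 ^+ 2 * cnorm (Delta eta b wt) /\
     1 / (1 - sigma) * Num.sqrt (Theta P s phi b)
         * cnorm (imag b)^-1 ^+ 2 * cnorm (Delta eta b wt) <=
       sigma / (1 - sigma) * Num.sqrt (Theta P s phi b)
         * cnorm (imag b)^-1).

Proof.
have ss := semicircular_sa hs; move=> w.
have [K0 bp] := upper_halfP hb.
set K := cnorm (imag b)^-1 in hDelta K0 bp *.
set D := Delta eta b wt in hDelta *.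
have k0 : 0 < K^-1 by rewrite invr_gt0.
have KN0 := lt0r_neq0 K0.
have s1 : 0 < 1 - sigma by lra.
have s1N := lt0r_neq0 s1.
have D0 := cnorm_ge0 D.
(* [wt] is an exact solution of the equation for [bt] *)
pose bt := b - D; pose e := (1 - sigma) * K^-1.
have e0 : 0 < e by rewrite mulr_gt0.
have btp : pos (imag bt - sc e).
  have -> : imag bt - sc e = (imag b - sc K^-1) + (sc (sigma * K^-1) - imag D).
    by rewrite /bt imagB /e mulrBl mul1r scB; ncring.
  apply: posD => //; apply: pos_scB; first exact: sa_imag.
  exact: le_trans (cnorm_imag _) hDelta.
have [d1 d10 wtp] : exists2 d, 0 < d & pos (- imag wt - sc d).
  by case: hwt => d d0 /pos_cpos h; exists d.
have wtE : wt = cauchy_transform P s bt.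
  have [d2 d20 gp] := cauchy_transform_lower hs e0 btp.
  apply: (semicircular_eq_unique hs e0 btp d10 wtp d20 gp).
    by rewrite /bt /D /Delta; ncring.
  have gu := lower_unit d20 gp.
  apply: (mulIr gu); rewrite mulVr // mulrBl (cauchy_transform_eq hs e0 btp).
  by rewrite addrK.
have [bu rb] := res_unit P ss k0 bp; have [btu rbt] := res_unit P ss e0 btp.
rewrite invrK in rb; have eV : e^-1 = K / (1 - sigma) by rewrite /e invfM invrK mulrC.
rewrite eV in rbt.
pose y := incl P D * resolvent P s bt.
have ny : cnorm y <= cnorm D * (K / (1 - sigma)).
  by apply: cnormM_le; rewrite ?incl_norm.
have wE : wt - w = expect P (resolvent P s b * y).
  rewrite wtE -linearB; congr (expect P _).
  have h1 : resolvent P s b * ((incl P bt - s) * resolvent P s bt) = resolvent P s b.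
    by rewrite mulrV // mulr1.
  have h2 : resolvent P s b * (incl P b - s) * resolvent P s bt = resolvent P s bt.
    by rewrite mulVr // mul1r.
  rewrite -/(resolvent P s b) -/(resolvent P s bt) -{1}h2 -{2}h1 /y.
  have -> : incl P D = (incl P b - s) - (incl P bt - s).
    by rewrite /bt (rmorphB _ b D) /=; ncring.
  by ncring.
have bound2 : cnorm D * K <= sigma.
  by rewrite -ler_pdivlMr.
split; first split.
- rewrite wE; apply: le_trans (cnorm_E _ _) _.
  apply: le_trans (cnormM_le rb ny) _.
  have -> : K * (cnorm D * (K / (1 - sigma))) = 1 / (1 - sigma) * K ^+ 2 * cnorm D.
    by field.
  by [].
- have -> : 1 / (1 - sigma) * K ^+ 2 * cnorm D =
      (cnorm D * K) * (K / (1 - sigma)) by field.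
  have -> : sigma / (1 - sigma) * K = sigma * (K / (1 - sigma)) by field.
  by rewrite ler_wpM2r // divr_ge0 // ltW.
move=> phi hphi; set T := Theta P s phi b; set r := resolvent P s b in wE.
pose F := complex.Re (phi (expect P (r * star r))).
have F0 : 0 <= F.
  rewrite /F -{1}(starK r).
  by have [] := state_pos hphi (E_pos P (pos_star (star r))).
have FT : F <= K ^+ 2 * T.
  have rp : pos (- imag r - sc K^-1 * (r * star r)).
    have -> : - imag r - sc K^-1 * (r * star r) =
        r * (imag (incl P b - s) - sc K^-1) * star r.
      by rewrite imag_invr // opprK mulrBr mulrBl scC mulrA.
    apply: pos_conjr; rewrite imagB (imag_sa ss) subr0 incl_imag -(incl_sc P) -rmorphB.
    exact: incl_pos.
  have [] := state_pos hphi (E_pos P rp).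
  have -> : expect P (- imag r - sc K^-1 * (r * star r))
      = - imag w - sc K^-1 * expect P (r * star r).
    by rewrite linearB linearN -E_imag -(incl_sc P) E_Ml.
  have -> : complex.Re (phi (- imag w - sc K^-1 * expect P (r * star r)))
      = - complex.Im (phi w) - K^-1 * F.
    rewrite linearB linearN state_sc -(state_imag hphi) /F.
    by move: (phi (imag w)) (phi (expect P _)) => [u1 u2] [u3 u4] /=; ring.
  move=> h _; have -> : K ^+ 2 * T = K * (- complex.Im (phi w)).
    by rewrite /T /Theta -/w -/K; field.
  by rewrite -ler_pdivrMl // mulrC; lra.
have T0 : 0 <= T by rewrite -(pmulr_rge0 _ (exprn_gt0 2 K0)) (le_trans F0).
have sT : 0 <= Num.sqrt T by apply: sqrtr_ge0.
split.
- rewrite -[phi wt - phi w](linearB phi) wE.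
  have := state_cauchy_schwarz P hphi (star r) y; rewrite starK -/F => cs.
  set rhs := (X in _ <= X).
  have -> : rhs = Num.sqrt T * K * (cnorm D * (K / (1 - sigma))) by rewrite /rhs; field.
  have nn : 0 <= normc (phi (expect P (r * y))).
    by case: (phi _) => u v; apply: sqrtr_ge0.
  have r0 : 0 <= cnorm D * (K / (1 - sigma)) by rewrite mulr_ge0 // divr_ge0 // ltW.
  have sK0 : 0 <= Num.sqrt T * K by rewrite mulr_ge0 // ltW.
  rewrite -ler_sqr ?nnegrE //; last exact: mulr_ge0.
  apply: le_trans cs _; rewrite exprMn; apply: ler_pM => //.
  + exact: sqr_ge0.
  + by rewrite exprMn sqr_sqrtr // mulrC.
  + by rewrite ler_sqr ?nnegrE ?cnorm_ge0.
- have -> : 1 / (1 - sigma) * Num.sqrt T * K ^+ 2 * cnorm D =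
      (cnorm D * K) * (Num.sqrt T * K / (1 - sigma)) by field.
  have -> : sigma / (1 - sigma) * Num.sqrt T * K =
      sigma * (Num.sqrt T * K / (1 - sigma)) by field.
  by rewrite ler_wpM2r // divr_ge0 ?mulr_ge0 // ltW.
Qed.
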